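(* Let $(M_1,g_1)$ and $(M_2,g_2)$ be Riemannian manifolds and let the twisted product $M_1\times_{\lambda_2}M_2$ be a complete and simply connected Riemannian manifold. If the mixed sectional curvature of $M_1\times_{\lambda_2}M_2$ is non-negative, then $M_1\times_{\lambda_2}M_2$ is isometric to a direct product $M_1\times M_2$ (that is, to $(M_1\times M_2,h_1\oplus h_2)$ for some Riemannian metrics $h_1$ on $M_1$ and $h_2$ on $M_2$).
   Context: Let $(M_1,g_1)$, $(M_2,g_2)$ be Riemannian manifolds, $\pi_i:M_1\times M_2\to M_i$ the canonical projections, and $\lambda_2:M_1\times M_2\to\mathbb{R}$ a strictly positive differentiable function. The twisted product $M_1\times_{\lambda_2}M_2$ is the manifold $M=M_1\times M_2$ with the Riemannian metric $g=\pi_1^*g_1+\lambda_2^2\,\pi_2^*g_2$. Let $\mathcal V$ be the distribution tangent to the leaves $M_1\times\{y\}$ and $\mathcal H$ the distribution tangent to $\{x\}\times M_2$; they are $g$-orthogonal and complementary. The mixed sectional curvature is the sectional curvature $\sec(X,Y)$ of $(M,g)$ on planes $\operatorname{span}\{X,Y\}$ with $0\ne X\in\mathcal V$ and $0\ne Y\in\mathcal H$ at the same point; non-negativity means $\sec(X,Y)\ge0$ for all such planes. *)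

(* Defs.v *)
From HB Require Import structures.
From mathcomp Require Import all_boot all_order all_algebra.
From mathcomp Require Import all_classical all_reals all_analysis.
Import Order.TTheory GRing.Theory Num.Theory.
Import numFieldNormedType.Exports.

Set Implicit Arguments.
Unset Strict Implicit.
Unset Printing Implicit Defensive.

Local Open Scope classical_set_scope.
Local Open Scope ring_scope.

(* A tensor field on a manifold is given by its component arrays in all the   *)
(* charts of the atlas, subject to the usual transformation law. Tangent      *)
(* vectors at p, read in the chart i, are row vectors; accordingly the        *)
(* differential of f at x is v |-> v *m 'J f x.                               *)

Section Smooth.
Variables (R : realType) (V W : normedModType R).

(* Meant for U open in a finite-dimensional V. *)
Fixpoint Ck (k : nat) (U : set V) (f : V -> W) : Prop :=
  (forall x, U x -> {for x, continuous f}) /\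
  (if k is k'.+1
   then forall v, (forall x, U x -> derivable f x v) /\ Ck k' U ('D_v f)
   else True).

Definition smooth (U : set V) (f : V -> W) := forall k, Ck k U f.

End Smooth.

Section SimplyConnected.
Variables (R : realType) (T : topologicalType).

Definition I01 : set R := `[0, 1].

Definition is_path (x y : T) (f : R -> T) :=
  [/\ {within I01, continuous f}, f 0 = x & f 1 = y].

Definition null_homotopic (x : T) (f : R -> T) :=
  exists H : R * R -> T,
    [/\ {within I01 `*` I01, continuous H},
        forall t, I01 t -> H (t, 0) = f t,
        forall t, I01 t -> H (t, 1) = x &
        forall s, I01 s -> H (0, s) = x /\ H (1, s) = x].

Definition simply_connected :=
  (forall x y, exists f, is_path x y f) /\
  (forall x f, is_path x x f -> null_homotopic x f).

End SimplyConnected.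
Arguments simply_connected R T : clear implicits.

(* Only the values of chart_map i on dom i and of its inverse chart_inv i on  *)
(* the image of dom i are meaningful.                                         *)
Record atlas (R : realType) (n : nat) (T : topologicalType) := Atlas {
  idx : Type;
  dom : idx -> set T;
  chart_map : idx -> T -> 'rV[R]_n;
  chart_inv : idx -> 'rV[R]_n -> T }.

Definition metric (R : realType) (n : nat) (T : topologicalType)
    (A : atlas R n T) := idx A -> T -> 'M[R]_n.

Section LocalRep.
Variables (R : realType) (n m : nat) (T S : topologicalType).
Variables (A : atlas R n T) (B : atlas R m S).

Definition local_rep (F : T -> S) (i : idx A) (j : idx B) :
  'rV[R]_n -> 'rV[R]_m := chart_map j \o F \o chart_inv i.

Definition smooth_map (F : T -> S) :=
  continuous F /\
  forall i j, smooth (chart_map i @` (dom i `&` F @^-1` dom j)) (local_rep F i j).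

End LocalRep.

Section Manifold.
Variables (R : realType) (n : nat) (T : topologicalType) (A : atlas R n T).

Definition is_chart (i : idx A) :=
  [/\ open (dom i), open (chart_map i @` dom i),
      forall p, dom i p -> chart_inv i (chart_map i p) = p,
      forall p, dom i p -> {for p, continuous (chart_map i)} &
      forall x, (chart_map i @` dom i) x -> {for x, continuous (chart_inv i)}].

Definition is_manifold :=
  [/\ hausdorff_space T, @second_countable T,
      forall p, exists i : idx A, dom i p,
      forall i : idx A, is_chart i &
      forall i j : idx A,
        smooth (chart_map i @` (dom i `&` dom j)) (local_rep id i j)].

Definition smooth_fun (f : T -> R) :=
  forall i : idx A, smooth (chart_map i @` dom i) (f \o chart_inv i : _ -> R^o).

Definition bilin (G : 'M[R]_n) (u v : 'rV[R]_n) : R := (u *m G *m v^T) 0 0.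

Definition is_riemannian (g : metric A) :=
  [/\ forall i p, dom i p -> (g i p)^T = g i p,
      forall i p, dom i p -> forall v, v != 0 -> 0 < bilin (g i p) v v,
      forall i, smooth (chart_map i @` dom i) (g i \o chart_inv i) &
      forall i j p, dom i p -> dom j p ->
        let J := 'J (local_rep id i j) (chart_map i p) in
        g i p = J *m g j p *m J^T].

Variable g : metric A.

Definition pderive (a : 'I_n) (f : 'rV[R]_n -> R) (x : 'rV[R]_n) : R :=
  'D_(delta_mx 0 a) (f : _ -> R^o) x.

Definition gcoef (i : idx A) (a b : 'I_n) (x : 'rV[R]_n) : R :=
  g i (chart_inv i x) a b.

(* Gamma^k_{ab} *)
Definition christoffel (i : idx A) (k a b : 'I_n) (x : 'rV[R]_n) : R :=
  2^-1 * \sum_l invmx (g i (chart_inv i x)) k l *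
    (pderive a (gcoef i b l) x + pderive b (gcoef i a l) x
     - pderive l (gcoef i a b) x).

(* R(d_a, d_b) d_c = \sum_l riemann l a b c *: d_l, for                       *)
(* R(X, Y) = [nabla_X, nabla_Y] - nabla_[X, Y].                               *)
Definition riemann (i : idx A) (l a b c : 'I_n) (x : 'rV[R]_n) : R :=
  pderive a (christoffel i l b c) x - pderive b (christoffel i l a c) x
  + \sum_m (christoffel i l a m x * christoffel i m b c x
            - christoffel i l b m x * christoffel i m a c x).

Definition curvature (i : idx A) (x : 'rV[R]_n) (X Y Z : 'rV[R]_n) : 'rV[R]_n :=
  \row_l \sum_a \sum_b \sum_c X 0 a * Y 0 b * Z 0 c * riemann i l a b c x.

Definition sectional_curvature (i : idx A) (p : T) (X Y : 'rV[R]_n) : R :=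
  let G := g i p in
  bilin G (curvature i (chart_map i p) X Y Y) X /
  (bilin G X X * bilin G Y Y - bilin G X Y ^+ 2).

Definition is_geodesic (gam : R -> T) :=
  continuous gam /\
  forall i : idx A,
    let c : R -> 'rV[R]_n := chart_map i \o gam in
    smooth (gam @^-1` dom i : set R^o) c /\
    forall t, dom i (gam t) -> forall k,
      derive1 (derive1 c) t 0 k
      + \sum_a \sum_b
          christoffel i k a b (c t) * derive1 c t 0 a * derive1 c t 0 b = 0.

(* Geodesic completeness: exp_p is defined on the whole tangent space. *)
Definition complete_riemannian :=
  forall (i : idx A) p (v : 'rV[R]_n), dom i p ->
    exists gam : R -> T,
      [/\ is_geodesic gam, gam 0 = p & derive1 (chart_map i \o gam) 0 = v].

End Manifold.

Definition is_isometry (R : realType) (n m : nat) (T S : topologicalType)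
    (A : atlas R n T) (B : atlas R m S) (g : metric A) (h : metric B)
    (F : T -> S) :=
  (exists F' : S -> T,
     [/\ cancel F F', cancel F' F, smooth_map A B F & smooth_map B A F']) /\
  (forall i j p, dom i p -> dom j (F p) ->
     let J := 'J (local_rep F i j) (chart_map i p) in
     g i p = J *m h j (F p) *m J^T).

Section Product.
Variables (R : realType) (n1 n2 : nat) (T1 T2 : topologicalType).
Variables (A1 : atlas R n1 T1) (A2 : atlas R n2 T2).

Definition prod_atlas : atlas R (n1 + n2) (T1 * T2)%type :=
  @Atlas R (n1 + n2) (T1 * T2)%type (idx A1 * idx A2)%type
    (fun i => dom i.1 `*` dom i.2)
    (fun i p => row_mx (chart_map i.1 p.1) (chart_map i.2 p.2))
    (fun i x => (chart_inv i.1 (lsubmx x), chart_inv i.2 (rsubmx x))).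

(* In product charts the differentials of the two projections are lsubmx and  *)
(* rsubmx, which gives the block form of pi_1^* g1 + lam^2 pi_2^* g2.         *)
Definition twisted_metric (g1 : metric A1) (g2 : metric A2)
    (lam : T1 * T2 -> R) : metric prod_atlas :=
  fun i p => block_mx (g1 i.1 p.1) 0 0 (lam p ^+ 2 *: g2 i.2 p.2).

Definition direct_metric (h1 : metric A1) (h2 : metric A2) :
    metric prod_atlas :=
  fun i p => block_mx (h1 i.1 p.1) 0 0 (h2 i.2 p.2).

(* The distributions tangent to the leaves T1 x {y} and {x} x T2. *)
Definition tangent_fst (X : 'rV[R]_(n1 + n2)) := rsubmx X = 0.
Definition tangent_snd (Y : 'rV[R]_(n1 + n2)) := lsubmx Y = 0.

Definition mixed_sec_nonneg (g : metric prod_atlas) :=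
  forall (i : idx prod_atlas) (p : T1 * T2) (X Y : 'rV[R]_(n1 + n2)),
    dom i p -> tangent_fst X -> X != 0 -> tangent_snd Y -> Y != 0 ->
    0 <= sectional_curvature g i p X Y.

End Product.

(* Main.v *)
Require Import Defs.
From HB Require Import structures.
From mathcomp Require Import all_boot all_order all_algebra.
From mathcomp Require Import all_classical all_reals all_analysis.
From mathcomp Require Import ring lra.
Import Order.TTheory GRing.Theory Num.Theory.
Import numFieldNormedType.Exports.

Set Implicit Arguments.
Unset Strict Implicit.
Unset Printing Implicit Defensive.

Local Open Scope classical_set_scope.
Local Open Scope ring_scope.

(** The leaves M1 x {y} of the product twisted by lam are totally geodesic, and for a
    unit vector X tangent to a leaf and a vector Y orthogonal to it

      sec(X, Y) = - Hess lam (X, X) / lam.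

    Hence non-negative mixed curvature says that lam is concave along the
    geodesics of the leaves.  By completeness these geodesics are defined on the
    whole real line, and a positive concave function on the line is constant.  So
    the differential of lam vanishes on vectors tangent to the leaves, and lam
    depends on y alone because M1 is connected.  The metric is then g1 + h2 with
    h2 = lam(x0, y)^2 g2 for any chosen x0, and the isometry is the identity.

    The curvature formula (mixed_sectional_curvatureE) is computed in a product
    chart, with the lowered curvature tensor of lower_riemann and the Christoffel
    symbols of the first kind.  Vanishing of the symbols christoffel_rll expresses
    that the leaves are totally geodesic.

    Completeness provides some geodesic with a given initial velocity; that it
    remains in the leaf (geodesic_stays_in_leaf) is a uniqueness statement.  The
    fibre part of the velocity satisfies a linear homogeneous differential
    equation with bounded coefficients, so it vanishes near each of its zeros
    (zero_ode), and a connectedness argument on the line concludes.  Along such a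
    geodesic the second derivative of lam is Hess lam of the velocity
    (lam_curve_derive2), and concave_pos_critical gives dlam = 0.

    Smoothness is phrased through iterated directional derivatives, so the chain
    rule along a curve and the block form of the Jacobian of a product transition
    map rest on C1_differentiable: continuous partial derivatives imply Frechet
    differentiability. *)

(** * Calculus of Ck maps *)

Section CkTheory.
Variables (R : realType) (V : normedModType R).
Implicit Types (W : normedModType R) (U : set V).

Lemma Ck_subset W k U U' (f : V -> W) : U' `<=` U -> Ck k U f -> Ck k U' f.
Proof.
elim: k f => [|k IH] f sU [cf df]; split => //; first by move=> x /sU /cf.
  by move=> x /sU /cf.
move=> v; have [dv /IH] := df v.
by move=> /(_ sU) ?; split => // x /sU /dv.
Qed.

Lemma Ck_pred W k U (f : V -> W) : Ck k.+1 U f -> Ck k U f.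
Proof.
elim: k f => [|k IH] f [cf df]; split => // v.
by have [dv /IH] := df v.
Qed.

(** A directional derivative at x depends on the germ of the function at x, so
    agreement on an open set passes to all iterated derivatives. *)
Lemma Ck_ext W k U (f g : V -> W) :
  open U -> (forall x, U x -> f x = g x) -> Ck k U f -> Ck k U g.
Proof.
move=> oU.
have nearU (f1 g1 : V -> W) x : (forall x, U x -> f1 x = g1 x) -> U x ->
    {near x, f1 =1 g1}.
  move=> fg Ux; have : nbhs x U by exact: open_nbhs_nbhs.
  by apply: filterS => y /fg.
elim: k f g => [|k IH] f g fg [cf df].
  split => // x Ux; rewrite /prop_for /continuous_at -(fg x Ux).
  by apply: cvg_trans (cf x Ux); apply: near_eq_cvg; exact: nearU.
split.
  move=> x Ux; rewrite /prop_for /continuous_at -(fg x Ux).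
  by apply: cvg_trans (cf x Ux); apply: near_eq_cvg; exact: nearU.
move=> v; have [dv Dv] := df v; split.
  by move=> x Ux; apply: (near_eq_derivable (nearU _ _ _ fg Ux)); exact: dv.
apply: IH Dv => x Ux.
by apply: near_eq_derive; exact: nearU.
Qed.

Lemma smooth_continuous W U (f : V -> W) x :
  smooth U f -> U x -> {for x, continuous f}.
Proof. by move=> /(_ 0%N) [cf _] /cf. Qed.

Lemma smooth_derivable W U (f : V -> W) x v :
  smooth U f -> U x -> derivable f x v.
Proof. by move=> /(_ 1%N) [_ /(_ v)] [dv _] /dv. Qed.

Lemma smooth_derive W U (f : V -> W) v : smooth U f -> smooth U ('D_v f).
Proof. by move=> sf k; have [_ /(_ v) []] := sf k.+1. Qed.

Lemma smooth_subset W U U' (f : V -> W) :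
  U' `<=` U -> smooth U f -> smooth U' f.
Proof. by move=> sU sf k; apply: Ck_subset sU (sf k). Qed.

Lemma smooth_ext W U (f g : V -> W) :
  open U -> (forall x, U x -> f x = g x) -> smooth U f -> smooth U g.
Proof. by move=> oU fg sf k; apply: Ck_ext oU fg (sf k). Qed.

Lemma Ck_cst W k U (c : W) : Ck k U (fun=> c).
Proof.
elim: k c => [|k IH] c; split => //; try by move=> x _; exact: cvg_cst.
move=> v; split; first by move=> x _; exact: derivable_cst.
have -> : 'D_v (fun=> c) = (fun=> 0) :> (V -> W).
  by apply/funext => x; exact: derive_cst.
exact: IH.
Qed.

Lemma CkD W k U (f g : V -> W) : open U ->
  Ck k U f -> Ck k U g -> Ck k U (fun x => f x + g x).
Proof.
move=> oU; elim: k f g => [|k IH] f g [cf df] [cg dg].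
  by split => // x Ux; apply: cvgD; [exact: cf|exact: cg].
split; first by move=> x Ux; apply: cvgD; [exact: cf|exact: cg].
move=> v; have [dfv Dfv] := df v; have [dgv Dgv] := dg v; split.
  by move=> x Ux; apply: (@derivableD _ _ _ f g); [exact: dfv|exact: dgv].
apply: Ck_ext oU _ (IH _ _ Dfv Dgv) => x Ux.
by rewrite -(@deriveD _ _ _ f g)//; [exact: dfv|exact: dgv].
Qed.

Lemma smooth_cst W U (c : W) : smooth U (fun=> c).
Proof. by move=> k; exact: Ck_cst. Qed.

Lemma smooth_id U : smooth U (id : V -> V).
Proof.
case=> [|k]; first by split => // x _; exact: cvg_id.
split=> [x _|v]; first exact: cvg_id.
split=> [x _|]; first exact: derivable_id.
have -> : 'D_v id = (fun=> v) :> (V -> V).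
  by apply/funext => x; exact: derive_id.
exact: Ck_cst.
Qed.

Lemma smoothD W U (f g : V -> W) : open U ->
  smooth U f -> smooth U g -> smooth U (fun x => f x + g x).
Proof. by move=> oU sf sg k; apply: CkD. Qed.

Lemma CkM k U (f g : V -> R^o) : open U ->
  Ck k U f -> Ck k U g -> Ck k U ((fun x => f x * g x) : V -> R^o).
Proof.
move=> oU; elim: k f g => [|k IH] f g Cf Cg.
  have [cf _] := Cf; have [cg _] := Cg.
  by split => // x Ux; apply: cvgM; [exact: cf|exact: cg].
have Cf' := Ck_pred Cf; have Cg' := Ck_pred Cg.
have [cf df] := Cf; have [cg dg] := Cg.
split; first by move=> x Ux; apply: cvgM; [exact: cf|exact: cg].
move=> v; have [dfv Dfv] := df v; have [dgv Dgv] := dg v; split.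
  by move=> x Ux; apply: (@derivableM _ _ f g); [exact: dfv|exact: dgv].
apply: Ck_ext oU _ (CkD oU (IH _ _ Cf' Dgv) (IH _ _ Cg' Dfv)) => x Ux.
by rewrite [RHS](@deriveM _ _ f g)//; [exact: dfv|exact: dgv].
Qed.

Lemma smoothM U (f g : V -> R^o) : open U ->
  smooth U f -> smooth U g -> smooth U ((fun x => f x * g x) : V -> R^o).
Proof. by move=> oU sf sg k; apply: CkM. Qed.

Lemma smooth_sum W (I : Type) (r : seq I) (P : pred I) U (F : I -> V -> W) :
  open U -> (forall i, P i -> smooth U (F i)) ->
  smooth U (fun x => \sum_(i <- r | P i) F i x).
Proof.
move=> oU sF; elim: r => [|i r IH].
  have -> : (fun x => \sum_(i <- [::] | P i) F i x) = (fun=> 0).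
    by apply/funext => x; rewrite big_nil.
  exact: smooth_cst.
have -> : (fun x => \sum_(j <- i :: r | P j) F j x) =
  (fun x => (if P i then F i x else 0) + \sum_(j <- r | P j) F j x).
  by apply/funext => x; rewrite big_cons; case: (P i); rewrite ?add0r.
apply: smoothD => //; have := sF i; case: (P i) => [|_]; last exact: smooth_cst.
exact.
Qed.

Lemma smooth_prod (I : Type) (r : seq I) U (F : I -> V -> R^o) :
  open U -> (forall i, smooth U (F i)) ->
  smooth U ((fun x => \prod_(i <- r) F i x) : V -> R^o).
Proof.
move=> oU sF; elim: r => [|i r IH].
  have -> : (fun x => \prod_(i <- [::]) F i x) = (fun=> 1).
    by apply/funext => x; rewrite big_nil.
  exact: smooth_cst.
have -> : (fun x => \prod_(j <- i :: r) F j x) =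
  (fun x => F i x * \prod_(j <- r) F j x).
  by apply/funext => x; rewrite big_cons.
exact: smoothM.
Qed.

(** The derivative of 1 / f is - f^-2 times that of f, so each order of
    differentiability of 1 / f follows from the preceding one. *)
Lemma smoothV U (f : V -> R^o) : open U -> (forall x, U x -> f x != 0) ->
  smooth U f -> smooth U ((fun x => (f x)^-1) : V -> R^o).
Proof.
move=> oU f0 sf; elim => [|k IH].
  split => // x Ux; apply: cvgV; [exact: f0|exact: smooth_continuous sf Ux].
split; first by move=> x Ux; apply: cvgV;
  [exact: f0|exact: smooth_continuous sf Ux].
move=> v; split.
  by move=> x Ux; apply: derivableV; [exact: f0|exact: smooth_derivable sf Ux].
have C2 : Ck k U ((fun x => (-1) * ((f x)^-1 * (f x)^-1) * 'D_v f x) : V -> R^o).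
  apply: CkM => //; last exact: smooth_derive sf _.
  by apply: CkM => //; [exact: Ck_cst|exact: CkM].
apply: Ck_ext oU _ C2 => x Ux.
rewrite [RHS]deriveV//; [|exact: f0|exact: smooth_derivable sf Ux].
by rewrite -invfM -expr2 mulN1r.
Qed.

Lemma mx_continuousP m n (M : V -> 'M[R]_(m, n)) x :
  {for x, continuous M} <->
  forall i j, {for x, continuous (fun y => M y i j : R^o)}.
Proof.
split=> [cM i j|cM].
  apply: (@continuous_comp _ _ _ M (fun A : 'M[R]_(m, n) => A i j : R^o)) => //.
  exact: coord_continuous.
apply/cvgrPdist_le => /= e e0; near=> y.
rewrite /Num.Def.normr/= mx_normrE (bigmax_le _ (ltW e0))//= => i _.
rewrite !mxE/=.
move: i; near: y; apply: filter_forall => /= i.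
exact: ((cvgrPdist_le _ _).1 (cM i.1 i.2)).
Unshelve. all: by end_near. Qed.

Lemma Ck_mxP m n k U (M : V -> 'M[R]_(m, n)) : open U ->
  Ck k U M <-> forall i j, Ck k U (fun y => M y i j : R^o).
Proof.
move=> oU; elim: k M => [|k IH] M.
  split=> [[cM _] i j|cM]; first by split => // x /cM /mx_continuousP.
  by split => // x Ux; apply/mx_continuousP => i j; have [+ _] := cM i j; exact.
split=> [[cM dM] i j|cM].
  split; first by move=> x /cM /mx_continuousP.
  move=> v; have [dv Dv] := dM v; split.
    by move=> x /dv /derivable_mxP.
  apply: Ck_ext oU _ ((IH _).1 Dv i j) => x Ux.
  by rewrite derive_mx ?mxE//; exact: dv.
split; first by move=> x Ux; apply/mx_continuousP => i j; have [+ _] := cM i j; exact.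
move=> v.
have dv x : U x -> derivable M x v.
  by move=> Ux; apply/derivable_mxP => i j; have [_ /(_ v) [+ _]] := cM i j; exact.
split => //; apply/IH => i j; have [_ /(_ v) [_ +]] := cM i j.
apply: Ck_ext oU _ => x Ux.
by rewrite derive_mx ?mxE//; exact: dv.
Qed.

Lemma smooth_mxP m n U (M : V -> 'M[R]_(m, n)) : open U ->
  smooth U M <-> forall i j, smooth U (fun y => M y i j : R^o).
Proof.
move=> oU; split=> [sM i j k|sM k]; first by apply: (Ck_mxP _ _ oU).1.
by apply/(Ck_mxP _ _ oU) => i j; exact: sM.
Qed.

Lemma smooth_det n U (M : V -> 'M[R]_n) : open U ->
  (forall i j, smooth U (fun y => M y i j : R^o)) ->
  smooth U ((fun y => \det (M y)) : V -> R^o).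
Proof.
move=> oU sM; rewrite /determinant.
apply: smooth_sum => // s _; apply: smoothM => //; first exact: smooth_cst.
by apply: smooth_prod.
Qed.

(** By Cramer's rule the entries of the inverse are rational functions of those
    of M, with denominator the determinant. *)
Lemma smooth_invmx n U (M : V -> 'M[R]_n) : open U ->
  (forall y, U y -> M y \in unitmx) ->
  (forall i j, smooth U (fun y => M y i j : R^o)) ->
  forall i j, smooth U (fun y => invmx (M y) i j : R^o).
Proof.
move=> oU uM sM i j.
have : smooth U ((fun y => (\det (M y))^-1 * ((-1) ^+ (j + i) *
    \det (row' j (col' i (M y))))) : V -> R^o).
  apply: smoothM => //.
    apply: smoothV => //; last exact: smooth_det.
    by move=> x /uM; rewrite unitmxE unitfE.
  apply: smoothM => //; first exact: smooth_cst.
  apply: smooth_det => // a b.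
  have -> : (fun y => row' j (col' i (M y)) a b : R^o) =
    (fun y => M y (lift j a) (lift i b)) by apply/funext => y; rewrite !mxE.
  exact: sM.
apply: smooth_ext => // x Ux.
by rewrite /invmx (uM x Ux) !mxE /cofactor.
Qed.

End CkTheory.

Lemma smooth_coord (R : realType) m n U i j :
  open U -> smooth U (fun A : 'M[R]_(m, n) => A i j : R^o).
Proof. by move=> oU; apply: (smooth_mxP _ oU).1; exact: smooth_id. Qed.

Section AffineSubstitution.
Variables (R : realType) (V V' W : normedModType R).
Variables (L : {linear V' -> V}) (c : V).
Hypothesis cL : continuous L.

(** Substituting an affine map turns difference quotients into difference
    quotients, so existence and value of derivatives transfer together. *)
Lemma growth_rate_affine (f : V -> W) v x :
  (fun h : R => h^-1 *: (((fun y => f (c + L y)) \o shift x) (h *: v) - f (c + L x))) =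
  (fun h => h^-1 *: ((f \o shift (c + L x)) (h *: L v) - f (c + L x))).
Proof. by apply/funext => h /=; rewrite (linearD L) (linearZZ L) addrCA addrA. Qed.

Lemma derive_affine (f : V -> W) v x :
  'D_v (fun x => f (c + L x)) x = 'D_(L v) f (c + L x).
Proof. by rewrite /derive growth_rate_affine. Qed.

Lemma Ck_affine k (U : set V) (f : V -> W) : Ck k U f ->
  Ck k ((fun x => c + L x) @^-1` U) (fun x => f (c + L x)).
Proof.
have cA : continuous (fun x => c + L x).
  by move=> x; apply: cvgD; [exact: cvg_cst|exact: cL].
elim: k f => [|k IH] f [cf df].
  by split => // x /= Ux; apply: continuous_comp; [exact: cA|exact: cf].
split.
  by move=> x /= Ux; apply: continuous_comp; [exact: cA|exact: cf].
move=> v; have [dv Dv] := df (L v); split; last first.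
  have -> : 'D_v (fun x => f (c + L x)) = (fun x => 'D_(L v) f (c + L x)).
    by apply/funext => x; exact: derive_affine.
  exact: (IH _ Dv).
by move=> x Ux; rewrite /derivable growth_rate_affine; exact: dv.
Qed.

Lemma smooth_affine (U : set V) (f : V -> W) : smooth U f ->
  smooth ((fun x => c + L x) @^-1` U) (fun x => f (c + L x)).
Proof. by move=> sf k; exact: Ck_affine. Qed.

End AffineSubstitution.

Section LinearSubstitution.
Variables (R : realType) (V V' W : normedModType R) (L : {linear V' -> V}).

Lemma derive_linear (f : V -> W) v x : 'D_v (f \o L) x = 'D_(L v) f (L x).
Proof.
have -> : f \o L = (fun y => f (0 + L y)).
  by apply/funext => y; rewrite add0r.
by rewrite (derive_affine L 0 f) add0r.
Qed.

Lemma smooth_linear (U : set V) (f : V -> W) : continuous L ->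
  smooth U f -> smooth (L @^-1` U) (f \o L).
Proof.
move=> cL /(smooth_affine 0 cL).
have -> : (fun y => 0 + L y) = L by apply/funext => y; rewrite add0r.
by have -> : (fun y => f (0 + L y)) = f \o L by apply/funext => y; rewrite add0r.
Qed.

End LinearSubstitution.

(** * Continuously differentiable maps are differentiable *)

(** The difference quotients of f along v and of its restriction to the line
    are the same function of the step. *)
Lemma is_derive_line (R : realType) (V W : normedModType R) (f : V -> W)
    (y v : V) (s : R) :
  derivable f (y + s *: v) v ->
  is_derive s (1 : R^o) ((fun t => f (y + t *: v)) : R^o -> W)
    ('D_v f (y + s *: v)).
Proof.
move=> df.
have E : (fun h : R => h^-1 *: ((((fun t => f (y + t *: v)) : R^o -> W) \o shift s)
      (h *: (1 : R^o)) - f (y + s *: v))) =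
    (fun h => h^-1 *: ((f \o shift (y + s *: v)) (h *: v) - f (y + s *: v))).
  apply/funext => h /=; rewrite [h *: (1 : R^o)]mulr1.
  by rewrite scalerDl addrCA.
by apply: DeriveDef; [rewrite /derivable E|rewrite /derive E].
Qed.

(** The increment b may have either sign, as do the coordinates of a small
    vector; the intermediate point is therefore located by its absolute value. *)
Lemma MVT_signed (R : realType) (phi dphi : R -> R) (b : R) :
  (forall s, `|s| <= `|b| -> is_derive s (1 : R) phi (dphi s)) ->
  exists2 c, `|c| <= `|b| & phi b - phi 0 = dphi c * b.
Proof.
move=> dphiP.
have cphi (s t : R) : (forall x, x \in `[s, t] -> `|x| <= `|b|) ->
    {within `[s, t], continuous phi}.
  move=> st; apply: derivable_within_continuous => x xst.
  exact: (@ex_derive _ _ _ _ _ _ _ (dphiP _ (st _ xst))).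
have [b0|b0] := leP 0 b.
  have sub x : x \in `[0, b] -> `|x| <= `|b|.
    by rewrite in_itv /= => /andP[x0 xb]; rewrite !ger0_norm.
  have [c cb E] := @MVT_segment _ phi dphi 0 b b0
    (fun x xb => dphiP _ (sub _ (subset_itv_oo_cc xb))) (cphi _ _ sub).
  by exists c; [exact: sub|rewrite E subr0].
have sub x : x \in `[b, 0] -> `|x| <= `|b|.
  rewrite in_itv /= => /andP[x0 xb]; rewrite !ler0_norm ?lerN2//.
  exact: ltW.
have [c cb E] := @MVT_segment _ phi dphi b 0 (ltW b0)
  (fun x xb => dphiP _ (sub _ (subset_itv_oo_cc xb))) (cphi _ _ sub).
by exists c; [exact: sub|rewrite -opprB E sub0r mulrN opprK].
Qed.

Lemma differentiable_of_littleo (R : realType) (V W : normedModType R)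
    (f : V -> W) (df : {linear V -> W}) (x : V) :
  continuous df ->
  (forall e, 0 < e -> \forall h \near (0 : V), `|f (h + x) - f x - df h| <= e * `|h|) ->
  differentiable f x.
Proof.
move=> cdf H.
have E : f \o shift x = cst (f x) + df +o_ (0 : V) id.
  apply/eqaddoP => e e0; near=> h.
  rewrite [X in `|X|](_ : _ = f (h + x) - f x - df h); last first.
    by rewrite -addrA -opprD.
  by near: h; exact: H.
by apply/diff_locallyP; rewrite (diff_unique cdf E).
Unshelve. all: by end_near. Qed.

Lemma rV_norm_le (R : realType) n (v : 'rV[R]_n) (e : R) : 0 <= e ->
  (forall k, `|v 0 k| <= e) -> `|v| <= e.
Proof.
move=> e0 ve; rewrite /Num.Def.normr/= mx_normrE (bigmax_le _ e0)//= => -[i j] _.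
by rewrite ord1 /=.
Qed.

Lemma rV_norm_ge (R : realType) n (v : 'rV[R]_n) k : `|v 0 k| <= `|v|.
Proof.
rewrite [leRHS]/Num.Def.normr/= mx_normrE; exact: (le_bigmax _ _ (0, k)).
Qed.

Section Truncation.
Variables (R : realType) (n : nat).
Implicit Type h : 'rV[R]_n.

(** The vertices of a broken line from 0 to h that changes one coordinate at a
    time. *)
Definition trunc_row h (m : nat) : 'rV[R]_n := \row_j (if (j < m)%N then h 0 j else 0).

Lemma trunc_row0 h : trunc_row h 0 = 0.
Proof. by apply/rowP => j; rewrite !mxE. Qed.

Lemma trunc_row_full h : trunc_row h n = h.
Proof. by apply/rowP => j; rewrite !mxE ltn_ord. Qed.

Lemma trunc_rowS h (k : 'I_n) :
  trunc_row h k.+1 = trunc_row h k + h 0 k *: delta_mx 0 k.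
Proof.
apply/rowP => j; rewrite !mxE eqxx /= ltnS leq_eqVlt.
have [->|jk] := eqVneq j k; first by rewrite eqxx ltnn mulr1 add0r.
by rewrite (negbTE (_ : nat_of_ord j != k)) //= mulr0 addr0.
Qed.

(** In the sup norm the whole broken line stays in the ball of radius |h|. *)
Lemma trunc_row_near h (k : 'I_n) (c : R) : `|c| <= `|h 0 k| ->
  `|trunc_row h k + c *: delta_mx 0 k| <= `|h|.
Proof.
move=> ch; apply: rV_norm_le => // j; rewrite !mxE eqxx /=.
have [->|jk] := eqVneq j k.
  by rewrite ltnn add0r mulr1 (le_trans ch)// rV_norm_ge.
rewrite mulr0 addr0; case: ifP => _; first exact: rV_norm_ge.
by rewrite normr0.
Qed.

End Truncation.

Section C1Differentiable.
Variables (R : realType) (n : nat).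
Implicit Types (U : set 'rV[R]_n) (f : 'rV[R]_n -> R^o).

(** The increment f (x + h) - f x telescopes along the broken line from x to
    x + h.  The mean value theorem replaces each step by h_k times a partial
    derivative at a point of the ball of radius |h|, and continuity of the
    partial derivatives bounds the error by e / (n + 1) |h_k|. *)
Lemma C1_differentiable U f x : open U -> Ck 1 U f -> U x -> differentiable f x.
Proof.
move=> oU [cf df] Ux.
pose D (k : 'I_n) : 'rV[R]_n -> R^o := 'D_(delta_mx 0 k) f.
have dfk (k : 'I_n) y : U y -> derivable f y (delta_mx 0 k).
  by move=> Uy; have [+ _] := df (delta_mx 0 k); exact.
have cD (k : 'I_n) y : U y -> {for y, continuous (D k)}.
  by move=> Uy; have [_ [+ _]] := df (delta_mx 0 k); exact.
pose g (h : 'rV[R]_n) : R^o := \sum_k h 0 k * D k x.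
have g_lin : linear g.
  move=> a u v; rewrite /g scaler_sumr -big_split; apply: eq_bigr => k _ /=.
  by rewrite !mxE mulrDl -mulrA.
pose gM := GRing.isLinear.Build R 'rV[R]_n R^o _ g g_lin.
pose gL : {linear 'rV[R]_n -> R^o} := HB.pack g gM.
apply: (@differentiable_of_littleo _ _ _ _ gL).
  move=> h; apply: (@smooth_continuous _ _ _ setT) => //.
  apply: smooth_sum => [|k _]; first exact: openT.
  apply: smoothM; [exact: openT| |exact: smooth_cst].
  by apply: smooth_coord; exact: openT.
move=> e e0.
(* The n steps share the error e; n.+1 avoids dividing by 0 when n = 0. *)
have e1 : 0 < e / n.+1%:R by rewrite divr_gt0.
have nearP : \forall y \near x, U y /\ forall k : 'I_n, `|D k x - D k y| <= e / n.+1%:R.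
  apply: filterI; first by apply: open_nbhs_nbhs; split.
  refine (@filter_forall _ _ _ _ (nbhs_filter x) _) => k.
  have /cvgrPdist_le /(_ _ e1) := cD k x Ux.
  exact.
move/nbhs_ballP : nearP => [r /= r0 ballP].
near=> h.
have hr : `|h| < r.
  by near: h; exact: (@nbhs0_lt R ('rV[R]_n : normedModType R) r r0).
have -> : f (h + x) - f x - gL h =
    \sum_(k < n) (f (x + trunc_row h k.+1) - f (x + trunc_row h k) - h 0 k * D k x).
  rewrite big_split /= sumrN; congr (_ - _).
  rewrite -(big_mkord xpredT (fun k => f (x + trunc_row h k.+1) - f (x + trunc_row h k))).
  rewrite telescope_sumr// trunc_row0 addr0 trunc_row_full.
  by rewrite addrC [x + h]addrC addrC.
apply: (le_trans (ler_norm_sum _ _ _)).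
apply: (@le_trans _ _ (\sum_(k < n) e / n.+1%:R * `|h|)); last first.
  rewrite sumr_const card_ord -[leLHS]mulr_natr mulrAC ler_wpM2r//.
  by rewrite mulrAC ler_pdivrMr// ler_wpM2l ?(ltW e0)// ler_nat.
apply: ler_sum => k _.
pose y := x + trunc_row h k.
have inball (s : R) : `|s| <= `|h 0 k| -> ball x r (y + s *: delta_mx 0 k).
  move=> sh; rewrite -ball_normE /= /y -addrA opprD addNKr normrN.
  exact: le_lt_trans (trunc_row_near sh) hr.
have [s hs|c ch E] := @MVT_signed _ (fun t => f (y + t *: delta_mx 0 k))
    (fun s => D k (y + s *: delta_mx 0 k)) (h 0 k).
  apply: is_derive_line; apply: dfk.
  by have [] := ballP _ (inball _ hs).
rewrite trunc_rowS addrA -/y.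
have -> : f y = f (y + 0 *: delta_mx 0 k) by rewrite scale0r addr0.
rewrite E mulrC -mulrBr normrM mulrC distrC ler_pM//; last exact: rV_norm_ge.
have [_ /(_ k)] := ballP _ (inball _ ch).
by [].
Unshelve. all: by end_near. Qed.

End C1Differentiable.

Lemma differentiable_rowP (R : realType) (V : normedModType R) m
    (M : V -> 'rV[R]_m) (x : V) :
  (forall j, differentiable (fun y => M y 0 j : R^o) x) -> differentiable M x.
Proof.
move=> dM.
pose d (j : 'I_m) := 'd (fun y => M y 0 j : R^o) x.
pose g (h : V) : 'rV[R]_m := \row_j (d j h).
have g_lin : linear g.
  by move=> a u v; apply/rowP => j; rewrite !mxE linearP.
pose gM := GRing.isLinear.Build R V 'rV[R]_m _ g g_lin.
pose gL : {linear V -> 'rV[R]_m} := HB.pack g gM.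
apply: (@differentiable_of_littleo _ _ _ _ gL).
  move=> y; apply/mx_continuousP => i j.
  have -> : (fun y => gL y i j : R^o) = d j by apply/funext => z; rewrite mxE.
  exact: diff_continuous.
move=> e e0.
have H : \forall h \near (0 : V),
    forall j : 'I_m, `|M (h + x) 0 j - M x 0 j - d j h| <= e * `|h|.
  apply: filter_forall => j.
  have := diff_locally (dM j) => /eqaddoP /(_ e e0).
  apply: filterS => h /=.
  rewrite [X in `|X| <= _ -> _](_ : _ = M (h + x) 0 j - M x 0 j - d j h)//.
  by rewrite -[RHS]addrA -[in RHS]opprD.
near=> h; apply: rV_norm_le; first by rewrite mulr_ge0// ltW.
by move=> k; rewrite !mxE; move: k; near: h.
Unshelve. all: by end_near. Qed.

Lemma smooth_differentiable (R : realType) n m (U : set 'rV[R]_n)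
    (f : 'rV[R]_n -> 'rV[R]_m) x :
  open U -> smooth U f -> U x -> differentiable f x.
Proof.
move=> oU sf Ux; apply: differentiable_rowP => j.
by apply: (C1_differentiable oU _ Ux); exact: ((Ck_mxP _ _ oU).1 (sf 1%N)).
Qed.

(** * The Levi-Civita connection in coordinates *)

Section PartialDerivatives.
Variables (R : realType) (n : nat) (U : set 'rV[R]_n).
Hypothesis oU : open U.
Implicit Types (f g : 'rV[R]_n -> R^o) (a : 'I_n).

Lemma smooth_pderive f a : smooth U f -> smooth U (pderive a f : _ -> R^o).
Proof. exact: smooth_derive. Qed.

Lemma pderive_eq f g a x :
  (forall y, U y -> f y = g y) -> U x -> pderive a f x = pderive a g x.
Proof.
move=> fg Ux; apply: near_eq_derive.
have : nbhs x U by exact: open_nbhs_nbhs.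
by apply: filterS => y /fg.
Qed.

Lemma pderiveM f g a x : smooth U f -> smooth U g -> U x ->
  pderive a (fun y => f y * g y) x = f x * pderive a g x + g x * pderive a f x.
Proof.
move=> sf sg Ux.
by rewrite /pderive [LHS](@deriveM _ _ f g)//; exact: smooth_derivable Ux.
Qed.

Lemma pderiveD f g a x : smooth U f -> smooth U g -> U x ->
  pderive a (fun y => f y + g y) x = pderive a f x + pderive a g x.
Proof.
move=> sf sg Ux.
by rewrite /pderive [LHS](@deriveD _ _ _ f g)//; exact: smooth_derivable Ux.
Qed.

Lemma pderive_cst (c : R) a x : pderive a (fun=> c) x = 0.
Proof. exact: derive_cst. Qed.

Lemma pderiveZ (c : R) f a x : smooth U f -> U x ->
  pderive a (fun y => c * f y) x = c * pderive a f x.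
Proof.
move=> sf Ux; rewrite (@pderiveM (fun=> c) f)//; last exact: smooth_cst.
by rewrite pderive_cst mulr0 addr0.
Qed.

Lemma pderive_sum (I : Type) (r : seq I) (F : I -> 'rV[R]_n -> R^o) a x :
  (forall i, smooth U (F i)) -> U x ->
  pderive a (fun y => \sum_(i <- r) F i y) x = \sum_(i <- r) pderive a (F i) x.
Proof.
move=> sF Ux; elim: r => [|i r IH].
  rewrite big_nil -[RHS](pderive_cst 0 a x); apply: pderive_eq => // y _.
  by rewrite big_nil.
rewrite big_cons -IH -pderiveD//; last exact: smooth_sum.
by apply: pderive_eq => // y _; rewrite big_cons.
Qed.

End PartialDerivatives.

Lemma pderive_const_dir (R : realType) n (f : 'rV[R]_n -> R) a x :
  (forall h, f (h *: delta_mx 0 a + x) = f x) -> pderive a f x = 0.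
Proof.
move=> fx; rewrite /pderive /derive.
have -> : (fun h : R => h^-1 *: (((f : _ -> R^o) \o shift x) (h *: delta_mx 0 a) - f x)) =
  (fun=> 0) by apply/funext => h /=; rewrite fx subrr scaler0.
exact: lim_cst.
Qed.

Section LeviCivita.
Variables (R : realType) (n : nat) (T : topologicalType) (A : atlas R n T).
Variables (g : metric A) (i : idx A) (U : set 'rV[R]_n).
Hypothesis oU : open U.
Hypothesis sym_g : forall a b x, U x -> gcoef g i a b x = gcoef g i b a x.
Hypothesis unit_g : forall x, U x -> g i (chart_inv i x) \in unitmx.
Hypothesis smooth_g : forall a b, smooth U (gcoef g i a b : _ -> R^o).

Local Notation G := (gcoef g i).
Local Notation Gam := (christoffel g i).

(** The Christoffel symbols of the first kind g(nabla_a d_b, d_k).  They are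
    free of the inverse metric, which keeps the curvature computation short. *)
Definition christoffel1 (k a b : 'I_n) (x : 'rV[R]_n) : R :=
  2^-1 * (pderive a (G b k) x + pderive b (G a k) x - pderive k (G a b) x).

Local Notation Gam1 := christoffel1.

Lemma christoffelE k a b x :
  Gam k a b x = \sum_l invmx (g i (chart_inv i x)) k l * Gam1 l a b x.
Proof.
by rewrite /christoffel mulr_sumr; apply: eq_bigr => l _; rewrite mulrCA.
Qed.

Lemma lower_christoffel k a b x : U x ->
  \sum_l G k l x * Gam l a b x = Gam1 k a b x.
Proof.
move=> Ux; under eq_bigr do rewrite christoffelE mulr_sumr.
rewrite exchange_big /= (bigD1 k)//= [X in _ + X]big1 => [|m mk].
  rewrite addr0; under eq_bigr do rewrite mulrA.
  rewrite -mulr_suml.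
  have := mulmxV (unit_g Ux) => /matrixP/(_ k k).
  by rewrite !mxE eqxx /= => ->; rewrite mul1r.
under eq_bigr do rewrite mulrA.
rewrite -mulr_suml.
have := mulmxV (unit_g Ux) => /matrixP/(_ k m).
by rewrite !mxE eq_sym (negbTE mk) /= => ->; rewrite mul0r.
Qed.

Lemma smooth_christoffel1 k a b : smooth U (Gam1 k a b : _ -> R^o).
Proof.
have sd c d e : smooth U (pderive c (G d e) : _ -> R^o) by exact: smooth_pderive.
apply: smoothM => //; first exact: smooth_cst.
apply: smoothD => //; first exact: smoothD.
have -> : (fun x => - pderive k (G a b) x : R^o) = (fun x => (-1) * pderive k (G a b) x).
  by apply/funext => x; rewrite mulN1r.
by apply: smoothM => //; exact: smooth_cst.
Qed.

Lemma smooth_christoffel k a b : smooth U (Gam k a b : _ -> R^o).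
Proof.
have -> : Gam k a b = (fun x => \sum_l invmx (g i (chart_inv i x)) k l * Gam1 l a b x).
  by apply/funext => x; exact: christoffelE.
apply: smooth_sum => // l _; apply: smoothM => //; last exact: smooth_christoffel1.
by apply: smooth_invmx.
Qed.

Lemma christoffel1_sym k a b x : U x -> Gam1 k a b x = Gam1 k b a x.
Proof.
move=> Ux; rewrite /Gam1 [pderive b _ x + _]addrC; congr (_ * (_ - _)).
by apply: (pderive_eq oU) => // y; exact: sym_g.
Qed.

(** This is nabla g = 0 in coordinates. *)
Lemma metric_compat a k m x : U x ->
  pderive a (G k m) x = Gam1 k a m x + Gam1 m a k x.
Proof.
move=> Ux; rewrite /Gam1.
rewrite (pderive_eq oU (f := G m k) (g := G k m))//; last by move=> y; exact: sym_g.
by field.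
Qed.

(** Differentiating lower_christoffel moves the metric inside the derivatives
    of the symbols at the cost of a term in the derivative of the metric; with
    metric_compat half of that term cancels against the quadratic part of the
    curvature tensor. *)
Lemma lower_riemann k a b c x : U x ->
  \sum_l G k l x * riemann g i l a b c x =
  pderive a (Gam1 k b c) x - pderive b (Gam1 k a c) x
  - \sum_m (Gam1 m a k x * Gam m b c x - Gam1 m b k x * Gam m a c x).
Proof.
move=> Ux.
have D a' b' : \sum_l G k l x * pderive a' (Gam l b' c) x =
    pderive a' (Gam1 k b' c) x
    - (\sum_l Gam1 k a' l x * Gam l b' c x + \sum_l Gam1 l a' k x * Gam l b' c x).
  apply/eqP; rewrite eq_sym subr_eq; apply/eqP.
  rewrite -(@pderive_eq _ _ U oU (fun y => \sum_l G k l y * Gam l b' c y) _ a' x)//;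
    last by move=> y Uy; exact: lower_christoffel.
  rewrite (pderive_sum oU) //; last first.
    by move=> l; apply: smoothM => //; exact: smooth_christoffel.
  rewrite -!big_split /=; apply: eq_bigr => l _.
  rewrite (pderiveM _ (smooth_g k l) (smooth_christoffel l b' c) Ux).
  by rewrite metric_compat// -mulrDl [X in _ + X]mulrC.
have Q a' b' : \sum_l G k l x * (\sum_m Gam l a' m x * Gam m b' c x) =
    \sum_m Gam1 k a' m x * Gam m b' c x.
  under eq_bigr do rewrite mulr_sumr.
  rewrite exchange_big /=; apply: eq_bigr => m _.
  under eq_bigr do rewrite mulrA.
  by rewrite -mulr_suml lower_christoffel.
rewrite [in RHS]sumrB.
transitivity ((\sum_l G k l x * pderive a (Gam l b c) x
    - \sum_l G k l x * pderive b (Gam l a c) x)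
  + (\sum_l G k l x * (\sum_m Gam l a m x * Gam m b c x)
    - \sum_l G k l x * (\sum_m Gam l b m x * Gam m a c x))).
  rewrite -!sumrB -big_split /=; apply: eq_bigr => l _.
  by rewrite /riemann sumrB mulrDr !mulrBr.
have alg (d d' s s' t t' : R) :
    d - (s + t) - (d' - (s' + t')) + (s - s') = d - d' - (t - t') by ring.
rewrite -(alg _ _ (\sum_m Gam1 k a m x * Gam m b c x)
  (\sum_m Gam1 k b m x * Gam m a c x)).
congr (_ - _ + (_ - _)); [exact: D|exact: D|exact: Q|exact: Q].
Qed.

(** Both sides are the inverse metric paired with two vectors of symbols of
    the first kind. *)
Lemma christoffel_pairing a b c d x : U x ->
  \sum_m Gam1 m a b x * Gam m c d x = \sum_m Gam m a b x * Gam1 m c d x.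
Proof.
move=> Ux.
under eq_bigr do rewrite -lower_christoffel// mulr_suml.
rewrite exchange_big /=; apply: eq_bigr => l _.
rewrite -(lower_christoffel _ _ _ Ux) mulr_sumr; apply: eq_bigr => m _.
by rewrite sym_g//; ring.
Qed.

End LeviCivita.

(** * Mixed curvature of a twisted product *)

Lemma chart_invP (R : realType) n (T : topologicalType) (A : atlas R n T) (i : idx A) x :
  is_chart i -> (chart_map i @` dom i) x ->
  dom i (chart_inv i x) /\ chart_map i (chart_inv i x) = x.
Proof. by case=> _ _ K _ _ [p dp <-]; rewrite (K p dp). Qed.

Lemma bilinE (R : realType) n (G : 'M[R]_n) u v :
  bilin G u v = \sum_a \sum_b u 0 a * G a b * v 0 b.
Proof.
rewrite /bilin mxE exchange_big /=; apply: eq_bigr => b _.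
by rewrite !mxE mulr_suml.
Qed.

Lemma bilin_block (R : realType) n1 n2 (A : 'M[R]_n1) (B : 'M[R]_n2) u v :
  bilin (block_mx A 0 0 B) u v =
  bilin A (lsubmx u) (lsubmx v) + bilin B (rsubmx u) (rsubmx v).
Proof.
rewrite /bilin -{1}(hsubmxK u) -{1}(hsubmxK v) mul_row_block !mulmx0 addr0 add0r.
by rewrite tr_row_mx mul_row_col mxE.
Qed.

Lemma bilinZ (R : realType) n (c : R) (A : 'M[R]_n) u v :
  bilin (c *: A) u v = c * bilin A u v.
Proof. by rewrite /bilin -scalemxAr -scalemxAl mxE. Qed.

(** A nonzero row killed by G would have length zero. *)
Lemma posdef_unit (R : realType) n (G : 'M[R]_n) :
  (forall v, v != 0 -> 0 < bilin G v v) -> G \in unitmx.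
Proof.
move=> pos; rewrite unitmxE unitfE; apply/negP => /det0P[v v0 vG].
by have := pos v v0; rewrite /bilin vG mul0mx mxE ltxx.
Qed.

Lemma sum_lshift (R : realType) n1 n2 (F : 'I_(n1 + n2) -> R) :
  (forall j, F (rshift n1 j) = 0) -> \sum_k F k = \sum_k F (lshift n2 k).
Proof. by move=> F0; rewrite big_split_ord /= [X in _ + X]big1 ?addr0. Qed.

Lemma sum_rshift (R : realType) n1 n2 (F : 'I_(n1 + n2) -> R) :
  (forall j, F (lshift n2 j) = 0) -> \sum_k F k = \sum_k F (rshift n1 k).
Proof. by move=> F0; rewrite big_split_ord /= [X in X + _]big1 ?add0r. Qed.

(** The curvature tensor enters only with its upper index lowered, the form
    computed by lower_riemann. *)
Lemma bilin_curvature (R : realType) n (T : topologicalType) (A : atlas R n T)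
    (g : metric A) (i : idx A) x X Y :
  (forall a b, gcoef g i a b x = gcoef g i b a x) ->
  bilin (g i (chart_inv i x)) (curvature g i x X Y Y) X =
  \sum_k \sum_a \sum_b \sum_c X 0 k * X 0 a * Y 0 b * Y 0 c *
    (\sum_l gcoef g i k l x * riemann g i l a b c x).
Proof.
move=> sym; rewrite bilinE exchange_big /=; apply: eq_bigr => k _.
transitivity (\sum_l \sum_a \sum_b \sum_c X 0 k * X 0 a * Y 0 b * Y 0 c *
    (gcoef g i k l x * riemann g i l a b c x)).
  apply: eq_bigr => l _; rewrite mxE !mulr_suml; apply: eq_bigr => a _.
  rewrite !mulr_suml; apply: eq_bigr => b _.
  rewrite !mulr_suml; apply: eq_bigr => c _.
  by rewrite sym /gcoef; ring.
rewrite exchange_big /=; apply: eq_bigr => a _.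
rewrite exchange_big /=; apply: eq_bigr => b _.
rewrite exchange_big /=; apply: eq_bigr => c _.
by rewrite mulr_sumr.
Qed.

Section ProductChart.
Variables (R : realType) (n1 n2 : nat) (M1 M2 : topologicalType).
Variables (A1 : atlas R n1 M1) (A2 : atlas R n2 M2).
Hypothesis man1 : is_manifold A1.
Hypothesis man2 : is_manifold A2.
Variable i : idx (prod_atlas A1 A2).

Local Notation U := (chart_map i @` dom i).
Local Notation U1 := (chart_map i.1 @` dom i.1).
Local Notation U2 := (chart_map i.2 @` dom i.2).

Lemma prod_chart_imageE : U = lsubmx @^-1` U1 `&` rsubmx @^-1` U2.
Proof.
apply/seteqP; split=> x /=.
  by case=> p [d1 d2] <-; rewrite row_mxKl row_mxKr; split; [exists p.1|exists p.2].
case=> -[p dp xp] [q dq xq]; exists (p, q) => //=.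
by rewrite xp xq hsubmxK.
Qed.

Lemma prod_chart_open : open U.
Proof.
have [_ _ _ /(_ i.1) [_ o1 _ _ _] _] := man1.
have [_ _ _ /(_ i.2) [_ o2 _ _ _] _] := man2.
rewrite prod_chart_imageE; apply: openI.
  by apply: open_comp => // x _; exact: continuous_lsubmx.
by apply: open_comp => // x _; exact: continuous_rsubmx.
Qed.

Lemma prod_chart_dom x : U x -> dom i (chart_inv i x).
Proof.
have [_ _ _ /(_ i.1) c1 _] := man1.
have [_ _ _ /(_ i.2) c2 _] := man2.
rewrite prod_chart_imageE => -[/= x1 x2].
by split; [have [] := chart_invP c1 x1|have [] := chart_invP c2 x2].
Qed.

Lemma smooth_lsubmx (W : normedModType R) (f : 'rV[R]_n1 -> W) :
  smooth U1 f -> smooth U (f \o lsubmx).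
Proof.
move=> sf; rewrite prod_chart_imageE; apply: smooth_subset (@subIsetl _ _ _) _.
exact: (smooth_linear (L := lsubmx)) (@continuous_lsubmx _ _ _ _) sf.
Qed.

Lemma smooth_rsubmx (W : normedModType R) (f : 'rV[R]_n2 -> W) :
  smooth U2 f -> smooth U (f \o rsubmx).
Proof.
move=> sf; rewrite prod_chart_imageE; apply: smooth_subset (@subIsetr _ _ _) _.
exact: (smooth_linear (L := rsubmx)) (@continuous_rsubmx _ _ _ _) sf.
Qed.

End ProductChart.

Section TwistedCurvature.
Variables (R : realType) (n1 n2 : nat) (M1 M2 : topologicalType).
Variables (A1 : atlas R n1 M1) (A2 : atlas R n2 M2).
Variables (g1 : metric A1) (g2 : metric A2) (lam : M1 * M2 -> R).
Hypothesis man1 : is_manifold A1.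
Hypothesis man2 : is_manifold A2.
Hypothesis riem1 : is_riemannian g1.
Hypothesis riem2 : is_riemannian g2.
Hypothesis smooth_lam : smooth_fun (prod_atlas A1 A2) lam.
Hypothesis lam_gt0 : forall p, 0 < lam p.
Variable i : idx (prod_atlas A1 A2).

Local Notation U := (chart_map i @` dom i).
Local Notation g := (twisted_metric g1 g2 lam).
Local Notation G := (gcoef g i).
Local Notation Gam := (christoffel g i).
Local Notation Gam1 := (christoffel1 g i).
Local Notation lft := (@lshift n1 n2).
Local Notation rgt := (@rshift n1 n2).

Definition lam_chart (x : 'rV[R]_(n1 + n2)) : R^o := lam (chart_inv i x).
Definition base_coef (a b : 'I_n1) (x : 'rV[R]_(n1 + n2)) : R^o :=
  g1 i.1 (chart_inv i.1 (lsubmx x)) a b.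
Definition fibre_coef (a b : 'I_n2) (x : 'rV[R]_(n1 + n2)) : R^o :=
  g2 i.2 (chart_inv i.2 (rsubmx x)) a b.

Local Notation L := lam_chart.
Local Notation P := base_coef.
Local Notation Q := fibre_coef.

Lemma gcoef_ll a b : G (lft a) (lft b) = P a b.
Proof. by apply/funext => x; rewrite /gcoef block_mxEul. Qed.

Lemma gcoef_lr a b : G (lft a) (rgt b) = (fun=> 0).
Proof. by apply/funext => x; rewrite /gcoef block_mxEur mxE. Qed.

Lemma gcoef_rl a b : G (rgt a) (lft b) = (fun=> 0).
Proof. by apply/funext => x; rewrite /gcoef block_mxEdl mxE. Qed.

Lemma gcoef_rr a b : G (rgt a) (rgt b) = (fun x => L x * L x * Q a b x).
Proof. by apply/funext => x; rewrite /gcoef block_mxEdr mxE expr2. Qed.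

Let oU : open U := @prod_chart_open _ _ _ _ _ _ _ man1 man2 i.

Lemma smooth_lam_chart : smooth U (L : _ -> R^o).
Proof. exact: smooth_lam. Qed.

Lemma smooth_base_coef a b : smooth U (P a b : _ -> R^o).
Proof.
have [_ _ /(_ i.1) s1 _] := riem1.
have [_ _ _ /(_ i.1) [_ o1 _ _ _] _] := man1.
by apply: (@smooth_lsubmx _ _ _ _ _ _ _ i R^o (fun y => g1 i.1 (chart_inv i.1 y) a b));
  exact: ((smooth_mxP _ o1).1 s1).
Qed.

Lemma smooth_fibre_coef a b : smooth U (Q a b : _ -> R^o).
Proof.
have [_ _ /(_ i.2) s2 _] := riem2.
have [_ _ _ /(_ i.2) [_ o2 _ _ _] _] := man2.
by apply: (@smooth_rsubmx _ _ _ _ _ _ _ i R^o (fun y => g2 i.2 (chart_inv i.2 y) a b));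
  exact: ((smooth_mxP _ o2).1 s2).
Qed.

Lemma smooth_twisted_coef a b : smooth U (G a b : _ -> R^o).
Proof.
case: (split_ordP a) => {}a ->; case: (split_ordP b) => {}b ->.
- by rewrite gcoef_ll; exact: smooth_base_coef.
- by rewrite gcoef_lr; exact: smooth_cst.
- by rewrite gcoef_rl; exact: smooth_cst.
rewrite gcoef_rr; apply: smoothM => //; last exact: smooth_fibre_coef.
by apply: smoothM => //; exact: smooth_lam_chart.
Qed.

Lemma twisted_coef_sym a b x : U x -> G a b x = G b a x.
Proof.
move=> /(prod_chart_dom man1 man2) [d1 d2].
have [/(_ _ _ d1) s1 _ _ _] := riem1.
have [/(_ _ _ d2) s2 _ _ _] := riem2.
have -> : G a b x = (g i (chart_inv i x))^T b a by rewrite mxE.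
by rewrite tr_block_mx s1 linearZ /= s2 !trmx0.
Qed.

Lemma fibre_coef_sym a b x : U x -> Q a b x = Q b a x.
Proof.
move=> /(prod_chart_dom man1 man2) [d1 d2].
have [/(_ _ _ d2) s2 _ _ _] := riem2.
by rewrite /fibre_coef -[in LHS]s2 mxE.
Qed.

Lemma twisted_posdef p v : dom i p -> v != 0 -> 0 < bilin (g i p) v v.
Proof.
move=> [d1 d2] v0.
have [_ /(_ _ _ d1) s1 _ _] := riem1.
have [_ /(_ _ _ d2) s2 _ _] := riem2.
rewrite bilin_block bilinZ.
have l2 : 0 < lam p ^+ 2 by rewrite exprn_gt0.
have [l0|/s1 ?] := eqVneq (lsubmx v) 0.
  have r0 : rsubmx v != 0.
    apply: contra_neq v0 => r0; rewrite -(hsubmxK v) l0 r0.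
    by rewrite row_mx0.
  by rewrite l0 {1}/bilin !mul0mx mxE add0r mulr_gt0// s2.
apply: ltr_wpDr => //.
have [->|/s2 ?] := eqVneq (rsubmx v) 0.
  by rewrite /bilin !mul0mx mxE mulr0.
by rewrite mulr_ge0 ?ltW.
Qed.

Lemma twisted_unit x : U x -> g i (chart_inv i x) \in unitmx.
Proof.
move=> /(prod_chart_dom man1 man2) d.
by apply: posdef_unit => v; exact: twisted_posdef.
Qed.

Lemma lsubmx_shift (h : R) b (x : 'rV[R]_(n1 + n2)) :
  lsubmx (h *: delta_mx 0 (rgt b) + x) = lsubmx x.
Proof. by apply/rowP => j; rewrite !mxE eq_lrshift andbF mulr0 add0r. Qed.

Lemma rsubmx_shift (h : R) b (x : 'rV[R]_(n1 + n2)) :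
  rsubmx (h *: delta_mx 0 (lft b) + x) = rsubmx x.
Proof. by apply/rowP => j; rewrite !mxE eq_rlshift andbF mulr0 add0r. Qed.

Lemma pderive_base_coef a b c x : pderive (rgt c) (P a b) x = 0.
Proof. by apply: pderive_const_dir => h; rewrite /base_coef lsubmx_shift. Qed.

Lemma pderive_fibre_coef a b c x : pderive (lft c) (Q a b) x = 0.
Proof. by apply: pderive_const_dir => h; rewrite /fibre_coef rsubmx_shift. Qed.

Lemma pderive_coef_rr k b c x : U x ->
  pderive (lft k) (G (rgt b) (rgt c)) x = 2 * L x * pderive (lft k) L x * Q b c x.
Proof.
move=> Ux; rewrite gcoef_rr.
have sL := smooth_lam_chart; have sQ := smooth_fibre_coef b c.
rewrite (pderiveM _ (smoothM oU sL sL) sQ Ux) (pderiveM _ sL sL Ux).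
by rewrite pderive_fibre_coef; ring.
Qed.

(** The second fundamental form of the fibres, along the gradient of lam. *)
Lemma christoffel1_lrr k b c x : U x ->
  Gam1 (lft k) (rgt b) (rgt c) x = - (L x * pderive (lft k) L x * Q b c x).
Proof.
move=> Ux; rewrite /christoffel1 pderive_coef_rr// !gcoef_rl !pderive_cst.
by field.
Qed.

Lemma christoffel1_llr k a c x : Gam1 (lft k) (lft a) (rgt c) x = 0.
Proof.
rewrite /christoffel1 gcoef_rl gcoef_ll gcoef_lr !pderive_cst pderive_base_coef.
by ring.
Qed.

Lemma christoffel1_rll m a k x : Gam1 (rgt m) (lft a) (lft k) x = 0.
Proof.
rewrite /christoffel1 !gcoef_lr gcoef_ll !pderive_cst pderive_base_coef.
by ring.
Qed.

(** In invariant terms, nabla_Y X = (X lam / lam) Y for coordinate fields X of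
    the base and Y of the fibre. *)
Lemma christoffel1_rl m b k x : U x ->
  Gam1 m (rgt b) (lft k) x = pderive (lft k) L x / L x * G (rgt b) m x.
Proof.
move=> Ux.
case: (split_ordP m) => {}m ->.
  rewrite (christoffel1_sym oU)//; last exact: twisted_coef_sym.
  by rewrite christoffel1_llr gcoef_rl mulr0.
rewrite /christoffel1 gcoef_lr gcoef_rl !pderive_cst pderive_coef_rr// gcoef_rr.
have L0 : L x != 0 by rewrite gt_eqF// /lam_chart.
by field.
Qed.

(** The leaves are totally geodesic. *)
Lemma christoffel_rll m a k x : U x -> Gam (rgt m) (lft a) (lft k) x = 0.
Proof.
move=> Ux; have := twisted_unit Ux.
rewrite christoffelE /twisted_metric => u.
rewrite (invmx_block_diag u) big_split_ord /=.
rewrite big1 => [|l _]; last by rewrite block_mxEdl mxE mul0r.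
by rewrite big1 ?addr0// => l _; rewrite christoffel1_rll mulr0.
Qed.

(** The Hessian of lam for the connection of the twisted product, on a pair of
    coordinate vectors tangent to the leaf. *)
Definition leaf_hessian a k x : R :=
  pderive (lft a) (pderive (lft k) L) x -
  \sum_m Gam m (lft a) (lft k) x * pderive m L x.

(** The derivative of christoffel1_lrr contributes the second derivative of lam
    and a term in the square of its differential.  The square cancels against
    the quadratic part coming from christoffel1_rl, while the pairing of
    christoffel1_lrr with the symbols of the leaf completes the second
    derivative to the Hessian. *)
Lemma mixed_riemann k a b c x : U x ->
  \sum_l G (lft k) l x * riemann g i l (lft a) (rgt b) (rgt c) x =
  - (L x * Q b c x * leaf_hessian a k x).
Proof.
move=> Ux.
have sym := twisted_coef_sym.
rewrite (lower_riemann oU sym twisted_unit smooth_twisted_coef)//.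
have L0 : L x != 0 by rewrite gt_eqF// /lam_chart.
have sL := smooth_lam_chart; have sQ := smooth_fibre_coef b c.
have sDL := smooth_pderive (lft k) sL.
rewrite (pderive_eq oU (g := fun y => (-1) * (L y * pderive (lft k) L y * Q b c y)))//;
  last by move=> y Uy; rewrite christoffel1_lrr// mulN1r.
rewrite (pderiveZ _ _ (smoothM oU (smoothM oU sL sDL) sQ) Ux).
rewrite (pderiveM _ (smoothM oU sL sDL) sQ Ux) (pderiveM _ sL sDL Ux).
rewrite pderive_fibre_coef.
rewrite (pderive_eq oU (f := Gam1 (lft k) (lft a) (rgt c)) (g := fun=> 0) _ _ Ux); last first.
  by move=> y Uy; rewrite christoffel1_llr.
rewrite pderive_cst sumrB.
rewrite (christoffel_pairing sym twisted_unit)//.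
have -> : \sum_m Gam m (lft a) (lft k) x * Gam1 m (rgt b) (rgt c) x =
    - (L x * Q b c x) * \sum_m Gam m (lft a) (lft k) x * pderive m L x.
  rewrite !sum_lshift => [|j|j]; last 2 first.
  - by rewrite christoffel_rll// mul0r.
  - by rewrite christoffel_rll// mul0r.
  rewrite mulr_sumr; apply: eq_bigr => m _.
  by rewrite christoffel1_lrr//; ring.
have -> : \sum_m Gam1 m (rgt b) (lft k) x * Gam m (lft a) (rgt c) x =
    pderive (lft k) L x * pderive (lft a) L x * Q b c x.
  under eq_bigr do rewrite christoffel1_rl// -mulrA.
  rewrite -mulr_sumr (lower_christoffel twisted_unit)//.
  rewrite (christoffel1_sym oU)// christoffel1_rl// gcoef_rr (fibre_coef_sym _ _ Ux).
  by field.
by rewrite /leaf_hessian; ring.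
Qed.

(** For an interval as base this is the classical - lam'' / lam. *)
Lemma mixed_sectional_curvatureE x u w : U x -> u != 0 -> w != 0 ->
  let X := row_mx u 0 in let Y := row_mx 0 w in
  sectional_curvature g i (chart_inv i x) X Y =
  - (\sum_a \sum_k u 0 a * u 0 k * leaf_hessian a k x) /
    (L x * bilin (g1 i.1 (chart_inv i.1 (lsubmx x))) u u).
Proof.
move=> Ux u0 w0 X Y.
have [d1 d2] := prod_chart_dom man1 man2 Ux.
have [_ /(_ _ _ d1 _ u0) pu _ _] := riem1.
have [_ /(_ _ _ d2 _ w0) pw _ _] := riem2.
have L0 : 0 < L x by rewrite /lam_chart.
have xE : chart_map i (chart_inv i x) = x.
  have [_ _ _ /(_ i.1) c1 _] := man1.
  have [_ _ _ /(_ i.2) c2 _] := man2.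
  have := Ux; rewrite prod_chart_imageE => -[/= x1 x2].
  by rewrite (chart_invP c1 x1).2 (chart_invP c2 x2).2 hsubmxK.
rewrite /sectional_curvature xE bilin_curvature; last first.
  by move=> a b; exact: twisted_coef_sym.
have Xl k : X 0 (lft k) = u 0 k by rewrite row_mxEl.
have Xr k : X 0 (rgt k) = 0 by rewrite row_mxEr mxE.
have Yl k : Y 0 (lft k) = 0 by rewrite row_mxEl mxE.
have Yr k : Y 0 (rgt k) = w 0 k by rewrite row_mxEr.
have -> : \sum_k \sum_a \sum_b \sum_c X 0 k * X 0 a * Y 0 b * Y 0 c *
      (\sum_l G k l x * riemann g i l a b c x) =
    - (L x * bilin (g2 i.2 (chart_inv i.2 (rsubmx x))) w w *
     \sum_a \sum_k u 0 a * u 0 k * leaf_hessian a k x).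
  rewrite sum_lshift => [|k]; last first.
    by rewrite !big1// => a _; rewrite big1// => b _; rewrite big1// => c _;
      rewrite Xr !mul0r.
  rewrite [in RHS]exchange_big /= mulr_sumr -sumrN; apply: eq_bigr => k _.
  rewrite sum_lshift => [|a]; last first.
    by rewrite !big1// => b _; rewrite big1// => c _; rewrite Xr mulr0 !mul0r.
  rewrite mulr_sumr -sumrN; apply: eq_bigr => a _.
  rewrite sum_rshift => [|b]; last first.
    by rewrite !big1// => c _; rewrite Yl mulr0 !mul0r.
  rewrite bilinE mulr_sumr !mulr_suml -sumrN; apply: eq_bigr => b _.
  rewrite sum_rshift => [|c]; last by rewrite Yl mulr0 !mul0r.
  rewrite mulr_sumr !mulr_suml -sumrN; apply: eq_bigr => c _.
  by rewrite mixed_riemann// Xl Xl Yr Yr /fibre_coef; ring.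
rewrite !bilin_block !bilinZ !row_mxKl !row_mxKr.
have z2 n (B : 'M[R]_n) : bilin B 0 0 = 0 by rewrite /bilin !mul0mx mxE.
have zl n (B : 'M[R]_n) v : bilin B 0 v = 0 by rewrite /bilin !mul0mx mxE.
have zr n (B : 'M[R]_n) v : bilin B v 0 = 0 by rewrite /bilin trmx0 mulmx0 mxE.
rewrite !z2 zl zr !mulr0 !addr0 !add0r expr0n /= subr0.
have -> : lam (chart_inv i x) = L x by [].
field.
by rewrite !gt_eqF.
Qed.

Lemma leaf_hessian_le0 x (u : 'rV[R]_n1) : (0 < n2)%N ->
  mixed_sec_nonneg (twisted_metric g1 g2 lam) -> U x ->
  \sum_a \sum_k u 0 a * u 0 k * leaf_hessian a k x <= 0.
Proof.
move=> n2_gt0 sec Ux.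
have [->|u0] := eqVneq u 0.
  by rewrite big1// => a _; rewrite big1// => k _; rewrite !mxE !mul0r.
(* Any nonzero fibre vector serves as the second side of the plane. *)
pose w : 'rV[R]_n2 := const_mx 1.
have w0 : w != 0.
  apply/eqP => /rowP /(_ (Ordinal n2_gt0)); rewrite !mxE; apply/eqP.
  exact: oner_neq0.
have d := prod_chart_dom man1 man2 Ux.
have [_ /(_ _ _ d.1 _ u0) pu _ _] := riem1.
have := sec i (chart_inv i x) (row_mx u 0) (row_mx 0 w) d.
rewrite /tangent_fst /tangent_snd row_mxKr row_mxKl.
have r0 : row_mx u (0 : 'rV[R]_n2) != 0.
  by apply: contra_neq u0 => /(congr1 lsubmx); rewrite row_mxKl linear0.
have s0 : row_mx (0 : 'rV[R]_n1) w != 0.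
  by apply: contra_neq w0 => /(congr1 rsubmx); rewrite row_mxKr linear0.
move=> /(_ erefl r0 erefl s0); rewrite mixed_sectional_curvatureE//.
by rewrite pmulr_lge0 ?oppr_ge0// invr_gt0 mulr_gt0// /lam_chart.
Qed.

End TwistedCurvature.

(** * One-variable analysis *)

(** On an interval around t0 so short that C times its half-length is at most
    1/2, the mean value theorem bounds the maximum of |w| by half of itself. *)
Lemma zero_ode (R : realType) m (w : R^o -> 'rV[R]_m) (t0 C : R) :
  w t0 = 0 ->
  (\forall t \near t0, derivable w t 1 /\ `|'D_1 w t| <= C * `|w t|) ->
  \forall t \near t0, w t = 0.
Proof.
move=> w0 /nbhs_ballP[r /= r0 H].
(* A positive constant above C, which may be nonpositive. *)
pose K := `|C| + 1.
have K0 : 0 < K by rewrite ltr_wpDl.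
pose d := Num.min (r / 2) (2 * K)^-1.
have d0 : 0 < d by rewrite lt_min divr_gt0//= invr_gt0 mulr_gt0.
have dK : K * d <= 2^-1.
  have : d <= (2 * K)^-1 by rewrite ge_min lexx orbT.
  by move=> /(ler_wpM2l (ltW K0)) /le_trans; apply; rewrite invfM mulrCA mulfV ?mulr1// gt_eqF.
have Hd t : `|t - t0| <= d -> derivable w t 1 /\ `|'D_1 w t| <= K * `|w t|.
  move=> td; have [] := H t.
    rewrite /ball /= distrC (le_lt_trans td)// (@le_lt_trans _ _ (r / 2))//.
      by rewrite ge_min lexx.
    by rewrite ltr_pdivrMr// ltr_pMr// ltr1n.
  move=> dw wC; split => //; apply: (le_trans wC).
  by rewrite ler_wpM2r// /K (le_trans (ler_norm _))// lerDl.
have inI t : (t \in `[t0 - d, t0 + d]) = (`|t - t0| <= d).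
  by rewrite in_itv /= ler_distl.
have cw : {within `[t0 - d, t0 + d], continuous (fun t => `|w t| : R)}.
  apply/continuous_in_subspaceT => t /[1!inE] /=; rewrite inI => td.
  have [/derivable1_diffP/differentiable_continuous cwt _] := Hd t td.
  exact: (cvg_norm cwt).
have le_I : t0 - d <= t0 + d by rewrite lerD2l ge0_cp// ltW.
have [t1 t1I t1max] := EVT_max le_I cw.
have half t : `|t - t0| <= d -> `|w t| <= 2^-1 * `|w t1|.
  move=> td; apply: rV_norm_le => [|k]; first by rewrite mulr_ge0.
  have [s hs|c hc E] := @MVT_signed _ (fun s : R => w (s + t0) 0 k)
      (fun s => 'D_1 w (s + t0) 0 k) (t - t0).
    have sd : `|s + t0 - t0| <= d by rewrite addrK (le_trans hs).
    have [dw _] := Hd _ sd.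
    have dwk := (derivable_mxP _ _ _).1 dw 0 k.
    have := @is_derive_line _ R^o R^o (fun t => w t 0 k) t0 1 s.
    rewrite [s *: (1 : R^o)]mulr1 [t0 + s]addrC => /(_ dwk).
    have -> : (fun t : R => w (t0 + t *: (1 : R^o)) 0 k) = (fun s : R => w (s + t0) 0 k).
      by apply/funext => z; rewrite [z *: (1 : R^o)]mulr1 addrC.
    by rewrite (derive_mx dw) mxE.
  move: E; rewrite subrK add0r w0 mxE subr0 => ->.
  have cd : `|c + t0 - t0| <= d by rewrite addrK (le_trans hc).
  have [_ Dc] := Hd _ cd.
  have wc : `|w (c + t0)| <= `|w t1| by apply: t1max; rewrite inI.
  rewrite normrM (@le_trans _ _ (K * `|w t1| * d))//.
    rewrite ler_pM//; apply: (le_trans (rV_norm_ge _ _)); apply: (le_trans Dc).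
    by rewrite ler_wpM2l// ltW.
  by rewrite mulrAC ler_wpM2r.
have w1 : `|w t1| = 0.
  apply/eqP; rewrite eq_le normr_ge0 andbT.
  have : `|w t1| <= 2^-1 * `|w t1| by apply: half; rewrite -inI.
  by lra.
apply/nbhs_ballP; exists d => //= t; rewrite /ball /= distrC => /ltW /half.
by rewrite w1 mulr0 normr_le0 => /eqP.
Qed.

(** A concave function lies below its tangent at 0, and a tangent that is not
    horizontal reaches the value 0 on one side. *)
Lemma concave_pos_critical (R : realType) (f : R^o -> R^o) :
  (forall t, derivable f t 1) -> (forall t, derivable ('D_1 f) t 1) ->
  (forall t, 'D_1 ('D_1 f) t <= 0) -> (forall t, 0 < f t) -> 'D_1 f 0 = 0.
Proof.
move=> df ddf dd0 f0.
have cont (h : R^o -> R^o) a b : (forall t, derivable h t 1) ->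
    {within `[a, b], continuous (h : R -> R)}.
  by move=> dh; apply: derivable_within_continuous => t _; exact: dh.
have nincr s t : s <= t -> 'D_1 f t <= 'D_1 f s.
  rewrite le_eqVlt => /predU1P[->//|st].
  have [z _|c _ E] := @MVT _ ('D_1 f) ('D_1 ('D_1 f)) s t st _ (cont _ _ _ ddf).
    exact: derivableP.
  rewrite -subr_le0 E; apply: mulr_le0_ge0; first exact: dd0.
  by rewrite subr_ge0 ltW.
have [neg|pos|//] := ltrgtP ('D_1 f 0) 0.
  (* The tangent at 0 vanishes at t. *)
  pose t := f 0 / - 'D_1 f 0.
  have t0 : 0 < t by rewrite divr_gt0// oppr_gt0.
  have [z _|c] := @MVT _ f ('D_1 f) 0 t t0 _ (cont _ _ _ df).
    exact: derivableP.
  rewrite in_itv /= => /andP[c0 _] E.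
  have : f t <= 0.
    rewrite -(subrK (f 0) (f t)) E subr0.
    have -> : f 0 = - 'D_1 f 0 * t.
      by rewrite /t mulrC divfK// oppr_eq0 lt_eqF.
    by rewrite -mulrDl mulr_le0_ge0// ?(ltW t0)// subr_le0 nincr// ltW.
  by rewrite leNgt f0.
(* The tangent at 0 vanishes at t. *)
pose t := - (f 0 / 'D_1 f 0).
have t0 : t < 0 by rewrite oppr_lt0 divr_gt0.
have [z _|c] := @MVT _ f ('D_1 f) t 0 t0 _ (cont _ _ _ df).
  exact: derivableP.
rewrite in_itv /= => /andP[_ c0] E.
have : f t <= 0.
  have -> : f t = f 0 + 'D_1 f c * t by move: E; lra.
  have -> : f 0 = - ('D_1 f 0 * t) by rewrite mulrN opprK mulrC divfK// gt_eqF.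
  rewrite addrC -mulrBl mulr_ge0_le0// ?(ltW t0)// subr_ge0 nincr//.
  exact: ltW.
by rewrite leNgt f0.
Qed.

Lemma derive_comp_curve (R : realType) n (U : set 'rV[R]_n) (f : 'rV[R]_n -> R^o)
    (c : R^o -> 'rV[R]_n) (t : R) :
  open U -> smooth U f -> U (c t) -> derivable c t 1 ->
  is_derive t (1 : R^o) (f \o c) (\sum_a 'D_1 c t 0 a * pderive a f (c t)).
Proof.
move=> oU sf Ut dc.
have df : differentiable f (c t) by exact: C1_differentiable oU (sf 1%N) Ut.
have dct : differentiable c t by exact/derivable1_diffP.
apply: DeriveDef; first exact/diff_derivable/differentiable_comp.
rewrite deriveE; last exact: differentiable_comp.
rewrite (diff_comp dct df) /= -(deriveE _ dct).
rewrite [in LHS](row_sum_delta ('D_1 c t)) linear_sum; apply: eq_bigr => a _.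
by rewrite linearZ /= -(deriveE _ df).
Qed.

(** * Geodesics tangent to a leaf *)

Lemma clopen_real_line (R : realType) (S : set R) :
  S !=set0 -> open S -> closed S -> S = setT.
Proof.
move=> S0 oS cS.
have cT : connected [set: R] by apply/connected_intervalP => x y _ _ z _.
by apply: cT S0 _ _; [exists S|exists S]; rewrite ?setTI.
Qed.

(** The left side is the second derivative of a function along a geodesic, with
    velocity v, second partial derivatives D2, first ones D1 and Christoffel
    symbols Gam; the right side is its Hessian on the base part of v. *)
Lemma leaf_sum (R : realType) n1 n2 (v : 'I_(n1 + n2) -> R) (D2 : 'I_(n1 + n2) -> 'I_(n1 + n2) -> R)
    (D1 : 'I_(n1 + n2) -> R) (Gam : 'I_(n1 + n2) -> 'I_(n1 + n2) -> 'I_(n1 + n2) -> R) :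
  (forall b, v (rshift n1 b) = 0) ->
  \sum_m (v m * (\sum_a v a * D2 a m) +
     D1 m * (- \sum_a \sum_b Gam m a b * v a * v b)) =
  \sum_a \sum_k v (lshift n2 a) * v (lshift n2 k) *
    (D2 (lshift n2 a) (lshift n2 k) - \sum_m Gam m (lshift n2 a) (lshift n2 k) * D1 m).
Proof.
move=> v0; rewrite big_split /=.
under [RHS]eq_bigr do under eq_bigr do rewrite mulrBr.
under [RHS]eq_bigr do rewrite sumrB.
rewrite sumrB; congr (_ + _).
  rewrite [RHS]exchange_big /= sum_lshift => [|k]; last by rewrite v0 mul0r.
  apply: eq_bigr => k _; rewrite mulr_sumr sum_lshift => [|a]; last first.
    by rewrite v0 mul0r mulr0.
  by apply: eq_bigr => a _; ring.
transitivity (\sum_m \sum_a \sum_k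
    - (v (lshift n2 a) * v (lshift n2 k) * (Gam m (lshift n2 a) (lshift n2 k) * D1 m))).
  apply: eq_bigr => m _; rewrite mulrN mulr_sumr -sumrN sum_lshift => [|a]; last first.
    by rewrite big1 ?mulr0 ?oppr0// => b _; rewrite v0 mulr0 mul0r.
  apply: eq_bigr => a _; rewrite mulr_sumr -sumrN sum_lshift => [|b]; last first.
    by rewrite v0 !mulr0 oppr0.
  by apply: eq_bigr => k _; ring.
rewrite exchange_big -sumrN /=; apply: eq_bigr => a _.
rewrite exchange_big -sumrN /=; apply: eq_bigr => k _.
by rewrite mulr_sumr -sumrN.
Qed.

Section LeafGeodesics.
Variables (R : realType) (n1 n2 : nat) (M1 M2 : topologicalType).
Variables (A1 : atlas R n1 M1) (A2 : atlas R n2 M2).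
Variables (g1 : metric A1) (g2 : metric A2) (lam : M1 * M2 -> R).
Hypothesis man1 : is_manifold A1.
Hypothesis man2 : is_manifold A2.
Hypothesis riem1 : is_riemannian g1.
Hypothesis riem2 : is_riemannian g2.
Hypothesis smooth_lam : smooth_fun (prod_atlas A1 A2) lam.
Hypothesis lam_gt0 : forall p, 0 < lam p.

Local Notation g := (twisted_metric g1 g2 lam).
Local Notation lft := (@lshift n1 n2).
Local Notation rgt := (@rshift n1 n2).

Variable gam : R -> M1 * M2.
Hypothesis geo : is_geodesic g gam.

Local Notation crd i := (chart_map i \o gam : R^o -> 'rV[R]_(n1 + n2)).
Local Notation vel i := ('D_1 (crd i)).

Lemma prod_dom_open (i : idx (prod_atlas A1 A2)) : open (dom i).
Proof.
have [_ _ _ /(_ i.1) [do1 _ _ _ _] _] := man1.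
have [_ _ _ /(_ i.2) [do2 _ _ _ _] _] := man2.
have -> : dom i = fst @^-1` dom i.1 `&` snd @^-1` dom i.2 :> set (M1 * M2).
  by [].
apply: openI.
  by apply: open_comp => // x _; exact: cvg_fst.
by apply: open_comp => // x _; exact: cvg_snd.
Qed.

Lemma prod_dom_cover (p : M1 * M2) :
  exists i : idx (prod_atlas A1 A2), dom i p.
Proof.
have [_ _ cov1 _ _] := man1; have [i1 d1] := cov1 p.1.
have [_ _ cov2 _ _] := man2; have [i2 d2] := cov2 p.2.
by exists (i1, i2).
Qed.

Section InChart.
Variable i : idx (prod_atlas A1 A2).
Local Notation U := (chart_map i @` dom i).
Local Notation D := (gam @^-1` dom i : set R^o).
Local Notation Gam := (christoffel g i).

Lemma geo_dom_open : open D.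
Proof.
have [cg _] := geo.
by apply: open_comp => [x _|]; [exact: cg|exact: prod_dom_open].
Qed.

Lemma geo_dom_near t : D t -> \forall s \near t, D s.
Proof. by move=> Dt; apply: open_nbhs_nbhs; split => //; exact: geo_dom_open. Qed.

Lemma crd_smooth : smooth D (crd i).
Proof. by have [_ /(_ i) [sc _]] := geo. Qed.

Lemma vel_smooth : smooth D (vel i).
Proof. by apply: smooth_derive; exact: crd_smooth. Qed.

Lemma crd_image t : D t -> U (crd i t).
Proof. by move=> Dt; exists (gam t). Qed.

Lemma chart_inv_crd t : D t -> chart_inv i (crd i t) = gam t.
Proof.
case=> d1 d2.
have [_ _ _ /(_ i.1) [_ _ K1 _ _] _] := man1.
have [_ _ _ /(_ i.2) [_ _ K2 _ _] _] := man2.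
by rewrite /= row_mxKl row_mxKr K1// K2//; case: (gam t).
Qed.

Lemma geodesic_eq t k : D t ->
  'D_1 (vel i) t 0 k = - \sum_a \sum_b Gam k a b (crd i t) * vel i t 0 a * vel i t 0 b.
Proof.
move=> Dt; have [_ /(_ i) [_ /(_ t Dt k)]] := geo.
have -> : derive1 (chart_map i \o gam) = vel i.
  by apply/funext => s; rewrite derive1E.
by rewrite derive1E => /eqP; rewrite addr_eq0 => /eqP.
Qed.

Lemma rsubmx_derive (c : R^o -> 'rV[R]_(n1 + n2)) t :
  derivable c t 1 ->
  is_derive t (1 : R^o) (rsubmx \o c) (rsubmx ('D_1 c t)).
Proof.
move=> dc; have drc : derivable (rsubmx \o c) t 1.
  apply/derivable_mxP => a b.
  have -> : (fun x => (rsubmx \o c) x a b) = (fun x => c x a (rgt b)).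
    by apply/funext => x /=; rewrite mxE.
  exact: ((derivable_mxP _ _ _).1 dc).
apply: DeriveDef => //.
rewrite (derive_mx drc) (derive_mx dc); apply/matrixP => a b; rewrite !mxE.
by congr ('D_1 _ t); apply/funext => x /=; rewrite mxE.
Qed.

(** A bound for the coefficients of the equation satisfied by the fibre part of
    the velocity. *)
Lemma christoffel_near_bounded t0 : D t0 ->
  exists B : R, \forall t \near t0, D t /\
    forall k a b, `|Gam k a b (crd i t)| * `|vel i t| <= B.
Proof.
move=> Dt0.
have oU := @prod_chart_open _ _ _ _ _ _ _ man1 man2 i.
pose F k a b (t : R^o) : R^o := `|Gam k a b (crd i t)| * `|vel i t|.
have cF k a b : {for t0, continuous (F k a b)}.
  apply: cvgM; apply: cvg_norm; last exact: smooth_continuous vel_smooth Dt0.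
  apply: (@continuous_comp _ _ _ (crd i) (Gam k a b : _ -> R^o)).
    exact: smooth_continuous crd_smooth Dt0.
  have sG := smooth_christoffel oU (twisted_unit man1 man2 riem1 riem2 lam_gt0 (i:=i))
    (smooth_twisted_coef man1 man2 riem1 riem2 smooth_lam i) k a b.
  exact: smooth_continuous sG (crd_image Dt0).
exists (\sum_k \sum_a \sum_b (F k a b t0 + 1)).
have F0 k a b t : 0 <= F k a b t by rewrite mulr_ge0.
apply: filterI; first exact: geo_dom_near.
have H : \forall t \near t0, forall kab : 'I_(n1 + n2) * 'I_(n1 + n2) * 'I_(n1 + n2),
    F kab.1.1 kab.1.2 kab.2 t <= F kab.1.1 kab.1.2 kab.2 t0 + 1.
  refine (@filter_forall _ _ _ _ (nbhs_filter t0) _) => kab.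
  have /cvgrPdist_le /(_ _ ltr01) := cF kab.1.1 kab.1.2 kab.2.
  apply: filterS => t; rewrite distrC => /(le_trans (ler_norm _)).
  by rewrite lerBlDl.
apply: filterS H => t Ht k a b.
apply: (le_trans (Ht (k, a, b))) => /=.
have pos k' a' b' : 0 <= F k' a' b' t0 + 1 by rewrite addr_ge0.
rewrite (bigD1 k)//=; apply: ler_wpDr.
  by rewrite sumr_ge0// => k' _; rewrite sumr_ge0// => a' _; rewrite sumr_ge0.
rewrite (bigD1 a)//=; apply: ler_wpDr.
  by rewrite sumr_ge0// => a' _; rewrite sumr_ge0.
by rewrite (bigD1 b)//=; apply: ler_wpDr => //; rewrite sumr_ge0.
Qed.

(** The symbols of christoffel_rll vanish, so every term of the geodesic
    equation for a fibre coordinate contains a fibre component of the velocity: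
    these components solve a linear homogeneous equation. *)
Lemma leaf_velocity_near t0 : D t0 -> rsubmx (vel i t0) = 0 ->
  \forall t \near t0, D t /\ rsubmx (vel i t) = 0.
Proof.
move=> Dt0 w0; have [B HB] := christoffel_near_bounded Dt0.
suff H : \forall t \near t0, (rsubmx \o vel i) t = 0.
  by apply: filterI; [exact: geo_dom_near|exact: H].
apply: (@zero_ode _ _ _ t0 ((n1 + n2)%:R * (n1 + n2)%:R * B)) => //.
apply: filterS HB => t [Dt Bt].
have dv : derivable (vel i) t 1 := smooth_derivable vel_smooth Dt.
have rv := rsubmx_derive dv.
split; first exact: ex_derive.
rewrite (@derive_val _ _ _ _ _ _ _ rv) /=.
have wv : `|rsubmx (vel i t)| <= `|vel i t|.
  by apply: rV_norm_le => // k; rewrite mxE rV_norm_ge.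
have wle j : `|vel i t 0 (rgt j)| <= `|rsubmx (vel i t)|.
  by have := rV_norm_ge (rsubmx (vel i t)) j; rewrite mxE.
have B0 : (0 < n2)%N -> 0 <= B.
  move=> n2_gt0; pose k := rgt (Ordinal n2_gt0).
  by apply: le_trans (Bt k k k); rewrite mulr_ge0.
apply: rV_norm_le => [|k].
  case: (posnP n2) => [n20|/B0 ?]; last by rewrite !mulr_ge0.
  have -> : rsubmx (vel i t) = 0.
    by apply/rowP => k; have := ltn_ord k; rewrite {2}n20.
  by rewrite normr0 mulr0.
rewrite mxE geodesic_eq// normrN.
apply: (le_trans (ler_norm_sum _ _ _)).
have card_sum (c : R) : (n1 + n2)%:R * c = \sum_(a < n1 + n2) c.
  by rewrite sumr_const card_ord mulr_natl.
rewrite -!mulrA card_sum; apply: ler_sum => a _.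
apply: (le_trans (ler_norm_sum _ _ _)).
rewrite card_sum; apply: ler_sum => b _.
rewrite normrM [X in X * _]normrM.
case: (split_ordP a) => {}a ->; last first.
  rewrite mulrAC ler_pM ?mulr_ge0//; apply: (le_trans _ (Bt (rgt k) (rgt a) b)).
  by rewrite ler_wpM2l// rV_norm_ge.
case: (split_ordP b) => {}b ->; last first.
  rewrite ler_pM ?mulr_ge0//; apply: (le_trans _ (Bt (rgt k) (lft a) (rgt b))).
  by rewrite ler_wpM2l// rV_norm_ge.
rewrite (christoffel_rll man1 man2 riem1 riem2 lam_gt0); last exact: crd_image.
by rewrite normr0 !mul0r mulr_ge0// B0// (leq_ltn_trans _ (ltn_ord k)).
Qed.

Lemma leaf_velocity_fibre_const t0 : D t0 -> rsubmx (vel i t0) = 0 ->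
  \forall t \near t0, (gam t).2 = (gam t0).2.
Proof.
move=> Dt0 w0; have /nbhs_ballP[r /= r0 H] := leaf_velocity_near Dt0 w0.
apply/nbhs_ballP; exists r => //= t; rewrite /ball /= distrC => tr.
have Hs s : `|s| <= `|t - t0| -> D (s + t0) /\ rsubmx (vel i (s + t0)) = 0.
  by move=> st; apply: H; rewrite /ball /= distrC addrK (le_lt_trans st).
have rE : rsubmx (crd i t) = rsubmx (crd i t0).
  apply/rowP => k.
  have [s hs|c hc E] := @MVT_signed _ (fun s : R => rsubmx (crd i (s + t0)) 0 k)
      (fun s => 0) (t - t0).
    have [Ds ws] := Hs s hs.
    have rd := rsubmx_derive (smooth_derivable crd_smooth Ds).
    have drk := (derivable_mxP _ _ _).1 (@ex_derive _ _ _ _ _ _ _ rd) 0 k.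
    have := @is_derive_line _ R^o R^o (fun t => rsubmx (crd i t) 0 k) t0 1 s.
    rewrite [s *: (1 : R^o)]mulr1 [t0 + s]addrC => /(_ drk).
    have -> : (fun t : R => rsubmx (crd i (t0 + t *: (1 : R^o))) 0 k) =
        (fun s : R => rsubmx (crd i (s + t0)) 0 k).
      by apply/funext => z; rewrite [z *: (1 : R^o)]mulr1 addrC.
    have -> : 'D_1 ((fun t : R^o => rsubmx (crd i t) 0 k) : R^o -> R^o) (s + t0) = 0.
      have := @derive_val _ _ _ _ _ _ _ rd.
      rewrite ws (derive_mx (@ex_derive _ _ _ _ _ _ _ rd)) => /matrixP /(_ 0 k).
      by rewrite !mxE.
    by [].
  by move: E; rewrite mul0r subrK add0r => /eqP; rewrite subr_eq0 => /eqP.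
have Dt : D t by have [] := Hs (t - t0) (lexx _); rewrite subrK.
by rewrite -(chart_inv_crd Dt) -(chart_inv_crd Dt0) /= -/(crd i t) rE.
Qed.

Lemma fibre_const_velocity t0 y : D t0 -> (\forall t \near t0, (gam t).2 = y) ->
  rsubmx (vel i t0) = 0.
Proof.
move=> Dt0 H.
have rd := rsubmx_derive (smooth_derivable crd_smooth Dt0).
rewrite -(@derive_val _ _ _ _ _ _ _ rd).
rewrite (@near_eq_derive _ _ _ _ (fun=> chart_map i.2 y)) ?derive_cst//.
by apply: filterS H => t /= <-; rewrite row_mxKr.
Qed.

End InChart.
(** The times around which the fibre coordinate is locally equal to its initial
    value form an open set by definition.  At a limit of such times the velocity
    is still tangent to the leaf, by continuity, so the fibre coordinate is
    constant around the limit as well, and the set is closed. *)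
Lemma geodesic_stays_in_leaf (i : idx (prod_atlas A1 A2)) : dom i (gam 0) -> rsubmx (vel i 0) = 0 ->
  forall t, (gam t).2 = (gam 0).2.
Proof.
move=> d0 w0.
pose S := interior [set t : R | (gam t).2 = (gam 0).2].
suff ST : S = setT.
  by move=> t; have : S t by [rewrite ST]; exact: interior_subset.
apply: clopen_real_line; last 2 first.
- exact: open_interior.
- move=> t clt.
  have [j dj] := prod_dom_cover (gam t).
  have wt : rsubmx (vel j t) = 0.
    apply/eqP/negPn/negP => wt.
    have cw : {for t, continuous (rsubmx \o vel j : R^o -> _)}.
      apply: continuous_comp; last exact: continuous_rsubmx.
      exact: smooth_continuous (vel_smooth j) dj.
    have : \forall s \near t, rsubmx (vel j s) != 0 by exact: cvgr_neq0 cw wt.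
    move=> /(filterI (geo_dom_near dj)) /clt [s [Ss [Ds /eqP]]].
    by apply; exact: (fibre_const_velocity Ds (y := (gam 0).2) Ss).
  have H := leaf_velocity_fibre_const dj wt.
  have [s [Ss /= st]] := clt _ H.
  have t2 : (gam t).2 = (gam 0).2 by rewrite -st; exact: (interior_subset Ss).
  by apply: filterS H => z /= ->.
exists 0.
have H := leaf_velocity_fibre_const
  (d0 : (gam @^-1` dom i : set R^o) 0) w0.
exact: H.
Qed.

Section InLeaf.
Variable y : M2.
Hypothesis in_leaf : forall t, (gam t).2 = y.

Lemma in_leaf_velocity (i : idx (prod_atlas A1 A2)) t : dom i (gam t) -> rsubmx (vel i t) = 0.
Proof.
move=> dt; have H : \forall s \near t, (gam s).2 = y by exact: filterE.
exact: (fibre_const_velocity dt H).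
Qed.

Local Notation phi := (lam \o gam : R^o -> R^o).

Lemma lam_curve_chart (i : idx (prod_atlas A1 A2)) t : dom i (gam t) ->
  \forall s \near t, (lam_chart lam i \o crd i) s = phi s.
Proof.
move=> dt; have := geo_dom_near dt.
by apply: filterS => s ds; exact: (congr1 lam (chart_inv_crd ds)).
Qed.

Lemma lam_curve_derive (i : idx (prod_atlas A1 A2)) t : dom i (gam t) ->
  is_derive t (1 : R^o) phi
    (\sum_a vel i t 0 a * pderive a (lam_chart lam i) (crd i t)).
Proof.
move=> dt; apply: (near_eq_is_derive (lam_curve_chart dt)).
apply: (@derive_comp_curve _ _ (chart_map i @` dom i)).
- exact: prod_chart_open.
- exact: smooth_lam_chart.
- exact: crd_image.
- exact: smooth_derivable (crd_smooth i) dt.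
Qed.

(** The geodesic equation replaces the second derivative of the curve by the
    Christoffel term of the Hessian. *)
Lemma lam_curve_derive2 (i : idx (prod_atlas A1 A2)) t : dom i (gam t) ->
  is_derive t (1 : R^o) ('D_1 phi)
    (\sum_a \sum_k lsubmx (vel i t) 0 a * lsubmx (vel i t) 0 k *
       leaf_hessian g1 g2 lam i a k (crd i t)).
Proof.
move=> dt.
pose U := chart_map i @` dom i.
have oU : open U by exact: prod_chart_open.
have Ut : U (crd i t) by exact: crd_image.
have sL : smooth U (lam_chart lam i : _ -> R^o) by exact: smooth_lam_chart.
have dcrd : derivable (crd i) t 1 := smooth_derivable (crd_smooth i) dt.
have dvel : derivable (vel i) t 1 := smooth_derivable (vel_smooth i) dt.
have nearE : \forall s \near t,
    (\sum_a (fun s => vel i s 0 a) * (pderive a (lam_chart lam i) \o crd i)) s = ('D_1 phi s : R^o).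
  have := geo_dom_near dt.
  apply: filterS => s ds; rewrite (@derive_val _ _ _ _ _ _ _ (lam_curve_derive ds)).
  by rewrite fct_sumE.
apply: (near_eq_is_derive nearE).
have dk (a : 'I_(n1 + n2)) := derive_comp_curve oU (smooth_pderive a sL) Ut dcrd.
have dv (a : 'I_(n1 + n2)) : is_derive t (1 : R^o) (fun s => vel i s 0 a : R^o)
    ('D_1 (vel i) t 0 a).
  apply: DeriveDef; first exact: ((derivable_mxP _ _ _).1 dvel).
  by rewrite (derive_mx dvel) mxE.
apply: (is_derive_eq (is_derive_sum (fun a => is_deriveM (dv a) (dk a)))).
have r0 b : vel i t 0 (rgt b) = 0.
  by have /rowP/(_ b) := in_leaf_velocity dt; rewrite !mxE.
have lE b : vel i t 0 (lft b) = lsubmx (vel i t) 0 b by rewrite mxE.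
under eq_bigr => m _ do rewrite (geodesic_eq)//.
rewrite (@leaf_sum _ _ _ (fun a => vel i t 0 a)
  (fun a m => pderive a (pderive m (lam_chart lam i)) (crd i t))
  (fun m => pderive m (lam_chart lam i) (crd i t))
  (fun m a b => christoffel g i m a b (crd i t)) r0).
by under eq_bigr do under eq_bigr do rewrite !lE.
Qed.

Lemma lam_curve_deriv0 (i : idx (prod_atlas A1 A2)) : (0 < n2)%N -> mixed_sec_nonneg g -> dom i (gam 0) ->
  \sum_a vel i 0 0 a * pderive a (lam_chart lam i) (crd i 0) = 0.
Proof.
move=> n2_gt0 sec d0.
rewrite -(@derive_val _ _ _ _ _ _ _ (lam_curve_derive d0)).
apply: concave_pos_critical => t.
- have [j dj] := prod_dom_cover (gam t).
  exact: (@ex_derive _ _ _ _ _ _ _ (lam_curve_derive dj)).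
- have [j dj] := prod_dom_cover (gam t).
  exact: (@ex_derive _ _ _ _ _ _ _ (lam_curve_derive2 dj)).
- have [j dj] := prod_dom_cover (gam t).
  rewrite (@derive_val _ _ _ _ _ _ _ (lam_curve_derive2 dj)).
  by apply: leaf_hessian_le0 => //; exact: crd_image.
- exact: lam_gt0.
Qed.

End InLeaf.
End LeafGeodesics.

(** * The twisting function is constant along the base *)

(** The image of the path is connected. *)
Lemma connected_pair_path (R : realType) (T : topologicalType) (K : set T) (p q : T) :
  (exists f : R -> T, is_path p q f) -> open K -> closed K -> K p -> K q.
Proof.
move=> [f [cf f0 f1]] oK cK Kp.
have cI : connected (f @` `[0, 1]).
  by apply: connected_continuous_connected => //; exact: segment_connected.
have in0 : (f @` `[0, 1]) (f 0) by exists 0 => //=; rewrite in_itv /= lexx ler01.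
have in1 : (f @` `[0, 1]) (f 1) by exists 1 => //=; rewrite in_itv /= lexx ler01.
have E : f @` `[0, 1] `&` K = f @` `[0, 1].
  apply: cI; [|by exists K|by exists K].
  by exists (f 0); split => //; rewrite f0.
by move: in1; rewrite f1 -E => -[].
Qed.

Section LambdaConstant.
Variables (R : realType) (n1 n2 : nat) (M1 M2 : topologicalType).
Variables (A1 : atlas R n1 M1) (A2 : atlas R n2 M2).
Variables (g1 : metric A1) (g2 : metric A2) (lam : M1 * M2 -> R).
Hypothesis man1 : is_manifold A1.
Hypothesis man2 : is_manifold A2.
Hypothesis riem1 : is_riemannian g1.
Hypothesis riem2 : is_riemannian g2.
Hypothesis smooth_lam : smooth_fun (prod_atlas A1 A2) lam.
Hypothesis lam_gt0 : forall p, 0 < lam p.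
Hypothesis n2_gt0 : (0 < n2)%N.
Hypothesis complete_M : complete_riemannian (twisted_metric g1 g2 lam).
Hypothesis sec : mixed_sec_nonneg (twisted_metric g1 g2 lam).

(** The geodesic issued from p in the direction of the coordinate vector stays
    in the leaf; along it lam is positive and concave, hence critical at p. *)
Lemma lam_pderive_base (i : idx (prod_atlas A1 A2)) x (a : 'I_n1) : (chart_map i @` dom i) x ->
  pderive (lshift n2 a) (lam_chart lam i) x = 0.
Proof.
case=> p dp <-{x}.
have [gam [geo gam0 v0]] := complete_M (delta_mx 0 (lshift n2 a)) dp.
have d0 : dom i (gam 0) by rewrite gam0.
have velE : 'D_1 (chart_map i \o gam : R^o -> 'rV[R]_(n1 + n2)) 0 = delta_mx 0 (lshift n2 a).
  by rewrite -v0 derive1E.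
have w0 : rsubmx ('D_1 (chart_map i \o gam : R^o -> 'rV[R]_(n1 + n2)) 0) = 0.
  by rewrite velE; apply/rowP => j; rewrite !mxE eq_rlshift andbF.
have leaf := geodesic_stays_in_leaf man1 man2 riem1 riem2 smooth_lam lam_gt0 geo d0 w0.
have := lam_curve_deriv0 man1 man2 riem1 riem2 smooth_lam lam_gt0 geo leaf n2_gt0 sec d0.
rewrite velE (bigD1 (lshift n2 a))//= big1 => [|b ba]; last first.
  by rewrite mxE eqxx (negbTE ba) mul0r.
by rewrite mxE !eqxx mul1r addr0 gam0.
Qed.

(** In a chart around x the segment towards a nearby point stays in the chart
    domain, and lam has derivative zero along it. *)
Lemma lam_base_locally_const x y : \forall x' \near x, lam (x', y) = lam (x, y).
Proof.
have [_ _ cov1 charts1 _] := man1; have [i1 d1] := cov1 x.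
have [_ _ cov2 charts2 _] := man2; have [i2 d2] := cov2 y.
have [do1 oU1 K1 c1 ci1] := charts1 i1.
have [_ _ K2 _ _] := charts2 i2.
pose i : idx (prod_atlas A1 A2) := (i1, i2).
have U1x : (chart_map i1 @` dom i1) (chart_map i1 x) by exists x.
have /nbhs_ballP[r /= r0 ballU] : nbhs (chart_map i1 x) (chart_map i1 @` dom i1).
  exact: open_nbhs_nbhs.
have H1 : \forall x' \near x, dom i1 x' by exact: open_nbhs_nbhs.
have H2 : \forall x' \near x, ball (chart_map i1 x) r (chart_map i1 x').
  by apply: (c1 x d1); exact: nbhsx_ballx.
apply: filterS2 H1 H2 => x' dx'; rewrite -ball_normE /= => bx'.
pose v := chart_map i1 x' - chart_map i1 x.
pose z (s : R) : 'rV[R]_(n1 + n2) :=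
  row_mx (chart_map i1 x) (chart_map i2 y) + s *: row_mx v 0.
have zE s : z s = row_mx (chart_map i1 x + s *: v) (chart_map i2 y).
  by rewrite /z scale_row_mx scaler0 add_row_mx addr0.
have Uz s : `|s| <= `|1 : R| -> (chart_map i @` dom i) (z s).
  move=> s1; rewrite prod_chart_imageE zE /=; split.
    rewrite row_mxKl; apply: ballU; rewrite -ball_normE /= opprD addNKr normrN normrZ.
    rewrite normr1 in s1; rewrite (le_lt_trans (ler_piMl _ s1))//.
    by rewrite distrC.
  by rewrite row_mxKr; exists y.
have [s s1|c _] := @MVT_signed _ (lam_chart lam i \o z) (fun=> 0) 1.
  have sL := smooth_lam_chart smooth_lam i.
  have oU := @prod_chart_open _ _ _ _ _ _ _ man1 man2 i.
  have dL : differentiable (lam_chart lam i) (z s) := C1_differentiable oU (sL 1%N) (Uz s s1).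
  have := is_derive_line (diff_derivable dL : derivable _ _ (row_mx v 0)).
  have -> : 'D_(row_mx v 0) (lam_chart lam i) (z s) = 0.
    rewrite deriveE// {1}(row_sum_delta (row_mx v 0)) linear_sum /= big1// => a _.
    rewrite linearZ /= -(deriveE _ dL).
    case: (split_ordP a) => {}a ->; last by rewrite row_mxEr mxE scale0r.
    by rewrite [X in _ *: X](lam_pderive_base a (Uz s s1)) scaler0.
  by [].
rewrite mul0r /= => /eqP; rewrite subr_eq0 => /eqP.
rewrite !zE scale0r scale1r addr0 /v addrC subrK /lam_chart /=.
by rewrite !row_mxKl !row_mxKr !K1// K2.
Qed.

Lemma lam_base_const x x' y : simply_connected R (M1 * M2)%type ->
  lam (x', y) = lam (x, y).
Proof.
move=> [pc _].
pose K := [set p : M1 * M2 | lam (p.1, y) = lam (x, y)].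
have near_fst (P : M1 -> Prop) (p : M1 * M2) : (\forall z \near p.1, P z) ->
    \forall q \near p, P q.1.
  by move=> H; apply: cvg_fst.
apply: (connected_pair_path (K := K) (pc (x, y) (x', y))) => //.
  rewrite openE => p /= Kp.
  have := near_fst _ p (lam_base_locally_const p.1 y).
  by apply: filterS => q /= E; rewrite /K /= E.
move=> p clp.
have [q [Kq /= E]] := clp _ (near_fst _ p (lam_base_locally_const p.1 y)).
by rewrite /K /= -E.
Qed.

End LambdaConstant.

(** * Direct products *)

Section DirectProduct.
Variables (R : realType) (n1 n2 : nat) (M1 M2 : topologicalType).
Variables (A1 : atlas R n1 M1) (A2 : atlas R n2 M2).
Hypothesis man1 : is_manifold A1.
Hypothesis man2 : is_manifold A2.

Lemma overlap_open n (T : topologicalType) (A : atlas R n T) (i : idx A) (D : set T) :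
  is_chart i -> open D -> open (chart_map i @` (dom i `&` D)).
Proof.
move=> [doi oU K c ci] oD; rewrite openE => _ [p [dp Dp] <-] /=.
have Ux : (chart_map i @` dom i) (chart_map i p) by exists p.
have H1 : \forall y \near chart_map i p, (chart_map i @` dom i) y by exact: open_nbhs_nbhs.
have H2 : \forall y \near chart_map i p, D (chart_inv i y).
  by apply: (ci _ Ux); rewrite K//; exact: open_nbhs_nbhs.
apply: filterS2 H1 H2 => _ [q dq <-]; rewrite K// => Dq.
by exists q.
Qed.

Lemma smooth_row_mx m1 m2 (V : normedModType R) (U : set V) (F1 : V -> 'rV[R]_m1)
    (F2 : V -> 'rV[R]_m2) : open U ->
  smooth U F1 -> smooth U F2 -> smooth U (fun x => row_mx (F1 x) (F2 x)).
Proof.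
move=> oU s1 s2; apply/smooth_mxP => // a b.
case: (split_ordP b) => {}b ->.
  have -> : (fun y => row_mx (F1 y) (F2 y) a (lshift m2 b)) = (fun y => F1 y a b).
    by apply/funext => y; rewrite row_mxEl.
  exact: ((smooth_mxP _ oU).1 s1).
have -> : (fun y => row_mx (F1 y) (F2 y) a (rshift m1 b)) = (fun y => F2 y a b).
  by apply/funext => y; rewrite row_mxEr.
exact: ((smooth_mxP _ oU).1 s2).
Qed.

Section Transition.
Variables i j : idx (prod_atlas A1 A2).

Let W1 := chart_map i.1 @` (dom i.1 `&` dom j.1).
Let W2 := chart_map i.2 @` (dom i.2 `&` dom j.2).
Let W := lsubmx @^-1` W1 `&` rsubmx @^-1` W2 : set 'rV[R]_(n1 + n2).

Lemma prod_overlap_sub : chart_map i @` (dom i `&` dom j) `<=` W.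
Proof.
move=> _ [p [[d1 d2] [e1 e2]] <-]; split => /=.
  by rewrite row_mxKl; exists p.1.
by rewrite row_mxKr; exists p.2.
Qed.

Let oW1 : open W1.
Proof.
have [_ _ _ ch _] := man1; apply: overlap_open => //.
by have [] := ch j.1.
Qed.

Let oW2 : open W2.
Proof.
have [_ _ _ ch _] := man2; apply: overlap_open => //.
by have [] := ch j.2.
Qed.

Let oW : open W.
Proof.
apply: openI.
  by apply: open_comp => // x _; exact: continuous_lsubmx.
by apply: open_comp => // x _; exact: continuous_rsubmx.
Qed.

Lemma prod_transition_smooth : smooth W (local_rep id i j).
Proof.
have [_ _ _ _ s1] := man1; have [_ _ _ _ s2] := man2.
apply: smooth_row_mx oW _ _.
  apply: smooth_subset (@subIsetl _ _ _) _.
  exact: (smooth_linear (L := lsubmx)) (@continuous_lsubmx _ _ _ _) (s1 i.1 j.1).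
apply: smooth_subset (@subIsetr _ _ _) _.
exact: (smooth_linear (L := rsubmx)) (@continuous_rsubmx _ _ _ _) (s2 i.2 j.2).
Qed.

(** A product of maps has a block diagonal differential; its entries are
    computed as directional derivatives, which commute with the two
    projections. *)
Lemma prod_transition_jacobian p : dom i p -> dom j p ->
  'J (local_rep id i j) (chart_map i p) =
  block_mx ('J (local_rep id i.1 j.1) (chart_map i.1 p.1)) 0 0
           ('J (local_rep id i.2 j.2) (chart_map i.2 p.2)).
Proof.
move=> [d1 d2] [e1 e2].
have [_ _ _ _ s1] := man1; have [_ _ _ _ s2] := man2.
set x := chart_map i p.
have x1 : lsubmx x = chart_map i.1 p.1 by rewrite row_mxKl.
have x2 : rsubmx x = chart_map i.2 p.2 by rewrite row_mxKr.
have Wx : W x by apply: prod_overlap_sub; exists p.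
have dF := smooth_differentiable oW prod_transition_smooth Wx.
have dF1 : differentiable (local_rep id i.1 j.1) (lsubmx x).
  by apply: (smooth_differentiable oW1 (s1 i.1 j.1)); case: Wx.
have dF2 : differentiable (local_rep id i.2 j.2) (rsubmx x).
  by apply: (smooth_differentiable oW2 (s2 i.2 j.2)); case: Wx.
apply/row_matrixP => k; rewrite !rowE.
set v : 'rV[R]_(n1 + n2) := delta_mx 0 k.
rewrite -(deriveEjacobian _ dF) -(hsubmxK v) mul_row_block !mulmx0 addr0 add0r hsubmxK.
rewrite -x1 -x2 -(deriveEjacobian _ dF1) -(deriveEjacobian _ dF2).
rewrite (derive_mx (diff_derivable dF : derivable _ _ v)).
rewrite (derive_mx (diff_derivable dF1 : derivable _ _ (lsubmx v))) (derive_mx (diff_derivable dF2 : derivable _ _ (rsubmx v))).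
apply/rowP => b; rewrite mxE.
case: (split_ordP b) => {}b ->.
  rewrite row_mxEl mxE.
  rewrite -(derive_linear lsubmx (fun y => local_rep id i.1 j.1 y 0 b : R^o)).
  by congr ('D_v _ x); apply/funext => y; rewrite /local_rep /= row_mxEl.
rewrite row_mxEr mxE.
rewrite -(derive_linear rsubmx (fun y => local_rep id i.2 j.2 y 0 b : R^o)).
by congr ('D_v _ x); apply/funext => y; rewrite /local_rep /= row_mxEr.
Qed.

End Transition.

(** The content is that the product atlas has smooth transition maps and that
    the direct metric obeys the transformation law between product charts. *)
Lemma direct_metric_isometry_id (h1 : metric A1) (h2 : metric A2) :
  is_riemannian h1 -> is_riemannian h2 ->
  is_isometry (direct_metric h1 h2) (direct_metric h1 h2) id.
Proof.
move=> [_ _ _ t1] [_ _ _ t2].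
have sid : smooth_map (prod_atlas A1 A2) (prod_atlas A1 A2) id.
  split=> [p|i j]; first exact: cvg_id.
  exact: smooth_subset (@prod_overlap_sub i j) (prod_transition_smooth i j).
split; first by exists id.
move=> i j p di dj /=.
rewrite (prod_transition_jacobian di dj) /direct_metric.
rewrite (t1 i.1 j.1 p.1)//; [|by case: di|by case: dj].
rewrite (t2 i.2 j.2 p.2)//; [|by case: di|by case: dj].
rewrite tr_block_mx !trmx0 !mulmx_block !mulmx0 !mul0mx !addr0 !add0r.
by rewrite !mul0mx.
Qed.

(** In charts this is lam restricted to an affine subspace. *)
Lemma smooth_lam_fibre (lam : M1 * M2 -> R) x0 :
  smooth_fun (prod_atlas A1 A2) lam -> smooth_fun A2 (fun q => lam (x0, q)).
Proof.
move=> slam j.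
have [_ _ cov1 charts1 _] := man1; have [i1 d1] := cov1 x0.
have [_ _ K1 _ _] := charts1 i1.
pose i : idx (prod_atlas A1 A2) := (i1, j).
pose L (y : 'rV[R]_n2) : 'rV[R]_(n1 + n2) := row_mx 0 y.
have L_lin : linear L.
  by move=> a u v; rewrite /L scale_row_mx add_row_mx scaler0 add0r.
pose LM := GRing.isLinear.Build R _ _ _ L L_lin.
pose LL : {linear 'rV[R]_n2 -> 'rV[R]_(n1 + n2)} := HB.pack L LM.
have cL : continuous LL.
  move=> y; apply: (@smooth_continuous _ _ _ setT) => //.
  apply: (@smooth_row_mx n1 n2 _ _ (fun=> 0) id openT); first exact: smooth_cst.
  exact: smooth_id.
have := smooth_affine (row_mx (chart_map i1 x0) 0) cL (slam i).
set c := row_mx _ _.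
have cLE y : c + LL y = row_mx (chart_map i1 x0) y.
  by rewrite /c /= /L add_row_mx addr0 add0r.
have -> : (fun y => (lam \o chart_inv i) (c + LL y)) =
    (fun q => lam (x0, q)) \o chart_inv j.
  by apply/funext => y; rewrite cLE /= row_mxKl row_mxKr K1.
apply: smooth_subset => y Uy.
suff : (chart_map i @` dom i) (c + LL y) by [].
rewrite prod_chart_imageE cLE /=.
by rewrite row_mxKl row_mxKr; split => //; exists x0.
Qed.

Lemma riemannian_scale (g2 : metric A2) (mu : M2 -> R) :
  is_riemannian g2 -> smooth_fun A2 mu -> (forall q, 0 < mu q) ->
  is_riemannian (fun j q => mu q ^+ 2 *: g2 j q : 'M[R]_n2).
Proof.
move=> [s2 p2 sm2 t2] smu mu0; split.
- by move=> j q dq; rewrite linearZ /= s2.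
- by move=> j q dq v v0; rewrite bilinZ mulr_gt0 ?exprn_gt0// p2.
- move=> j; have [_ _ _ /(_ j) [_ oU _ _ _] _] := man2.
  apply/(smooth_mxP _ oU) => a b.
  have -> : (fun y => ((fun q => mu q ^+ 2 *: g2 j q : 'M[R]_n2) \o chart_inv j) y a b) =
     (fun y => (mu \o chart_inv j) y * (mu \o chart_inv j) y * (g2 j \o chart_inv j) y a b).
    by apply/funext => y; rewrite /= !mxE expr2.
  apply: smoothM => //; first by apply: smoothM => //; exact: smu.
  exact: ((smooth_mxP _ oU).1 (sm2 j)).
- move=> i j q di dj /=.
  by rewrite (t2 i j q di dj) /= -scalemxAr -scalemxAl.
Qed.

End DirectProduct.

Theorem theorem2 (R : realType) (n1 n2 : nat) (M1 M2 : topologicalType)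
    (A1 : atlas R n1 M1) (A2 : atlas R n2 M2)
    (g1 : metric A1) (g2 : metric A2) (lambda2 : M1 * M2 -> R)
    (manM1 : is_manifold A1) (manM2 : is_manifold A2)
    (riem_g1 : is_riemannian g1) (riem_g2 : is_riemannian g2)
    (smooth_lambda2 : smooth_fun (prod_atlas A1 A2) lambda2)
    (lambda2_gt0 : forall p, 0 < lambda2 p)
    (complete_M : complete_riemannian (twisted_metric g1 g2 lambda2))
    (sc_M : simply_connected R (M1 * M2)%type)
    (mixed_sec_ge0 : mixed_sec_nonneg (twisted_metric g1 g2 lambda2)) :
  exists (h1 : metric A1) (h2 : metric A2) (F : M1 * M2 -> M1 * M2),
    [/\ is_riemannian h1, is_riemannian h2 &
        is_isometry (twisted_metric g1 g2 lambda2) (direct_metric h1 h2) F].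
Proof.
suff [h2 riem_h2 E] : exists2 h2 : metric A2, is_riemannian h2 &
    twisted_metric g1 g2 lambda2 = direct_metric g1 h2.
  by exists g1, h2, id; rewrite E; split => //; exact: direct_metric_isometry_id.
have [[p0 _]|noM] := pselect (exists p : M1 * M2, True); last first.
  exists g2 => //; apply/funext => i; apply/funext => p.
  by exfalso; apply: noM; exists p.
(* Without fibre directions there is no mixed plane and lambda2 is arbitrary, but
   the fibre block of the metric is empty. *)
have [n2_0|n2_gt0] := posnP n2.
  exists g2 => //; apply/funext => i; apply/funext => p.
  by rewrite /twisted_metric /direct_metric; congr block_mx; apply/matrixP => a;
    have := ltn_ord a; rewrite {2}n2_0.
exists (fun j q => lambda2 (p0.1, q) ^+ 2 *: g2 j q : 'M[R]_n2).
  apply: riemannian_scale => //; exact: smooth_lam_fibre smooth_lambda2.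
apply/funext => i; apply/funext => -[x y]; rewrite /twisted_metric /direct_metric.
congr (block_mx _ _ _ (_ ^+ 2 *: _)).
exact: (lam_base_const manM1 manM2 riem_g1 riem_g2 smooth_lambda2 lambda2_gt0
  n2_gt0 complete_M mixed_sec_ge0).
Qed.
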